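(* Let $P$ be an $n$-gon with $3\le n\le 8$, with vertices $p_0,\dots,p_{n-1}$ labelled in cyclic order and indices taken modulo $n$. Then there exist a starting index $s$ and a direction $\varepsilon\in\{+1,-1\}$ with the following property. Place guards at the vertices $p_{s+3k\varepsilon}$ for all integers $k$ with $0\le 3k<n$. These guards together see every point of $P$.
   Context: A polygon is a closed region of the plane bounded by a simple closed polygonal curve. A guard at a point $p$ of a polygon $P$ sees a point $q\in P$ if and only if the line segment $\overline{pq}$ is contained in $P$. The guard placement in the claim is the ''every third vertex'' strategy. Starting at vertex $p_s$, one moves either clockwise ($\varepsilon=+1$) or counterclockwise ($\varepsilon=-1$) around $P$. A guard is placed at every third vertex, stopping just before passing the initial guard. This uses $\lceil n/3\rceil$ guards; for $n=8$, for example, it gives guards at $p_s$, $p_{s+3\varepsilon}$ and $p_{s+6\varepsilon}$. *)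

(* Defs.v *)
From HB Require Import structures.
From mathcomp Require Import all_boot all_order all_algebra.
From mathcomp Require Import all_classical all_reals all_analysis.

Set Implicit Arguments.
Unset Strict Implicit.
Unset Printing Implicit Defensive.

Import Order.TTheory GRing.Theory Num.Theory.
Import numFieldNormedType.Exports.

Local Open Scope classical_set_scope.
Local Open Scope ring_scope.

(* The plane is R * R; the sup norm on it induces the usual topology and the
   usual bounded sets. The vertices of an n-gon are indexed by 'Z_n, so that
   index arithmetic is modulo n; this is meaningful only for 1 < n. *)

Definition seg_point (R : realType) (a b : R * R) (t : R) : R * R :=
  (1 - t) *: a + t *: b.

Definition segment (R : realType) (a b : R * R) : set (R * R) :=
  [set seg_point a b t | t in `[0, 1]].

Definition polygonal_curve (R : realType) (n : nat) (p : 'Z_n -> R * R) :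
    set (R * R) :=
  \bigcup_(i in [set: 'Z_n]) segment (p i) (p (i + 1)).

(* The parametrization of the closed curve (i, t) |-> seg_point (p i) (p (i + 1)) t
   by t in [0, 1[ is injective: the curve visits no point twice, which covers
   distinctness of vertices and both adjacent and non-adjacent edges. Straight
   angles at vertices are allowed. *)
Definition simple_polygonal_curve (R : realType) (n : nat)
    (p : 'Z_n -> R * R) : Prop :=
  forall (i j : 'Z_n) (t u : R), 0 <= t < 1 -> 0 <= u < 1 ->
    seg_point (p i) (p (i + 1)) t = seg_point (p j) (p (j + 1)) u ->
    i = j /\ t = u.

(* The region bounded by the curve: the curve together with the bounded
   components of its complement. *)
Definition polygon (R : realType) (n : nat) (p : 'Z_n -> R * R) :
    set (R * R) :=
  polygonal_curve p `|`
  [set q | ~ polygonal_curve p q /\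
           bounded_set (connected_component (~` polygonal_curve p) q)].

Definition sees (R : realType) (P : set (R * R)) (g q : R * R) : Prop :=
  segment g q `<=` P.

(* Main.v *)
(* For a point off the curve let [par] be the parity of the number of edges met
   by a horizontal ray.  It is constant along segments that avoid the curve and
   flips across every edge.  Near each of its points a simple curve cuts a small
   box in two pieces, so the points of equal parity near the curve can be joined
   by following the curve, and the points of parity 1 are exactly those of the
   bounded components.
   The lowest vertex has a nondegenerate corner, and either the segment joining
   its neighbours or the one from it to a vertex of that corner is an inner
   diagonal.  Cutting along it yields two simple polygons whose regions cover the
   given one; iterating, every point of the region lies in a triangle contained in
   the region.  A finite check shows that each triangulation of an n-gon with
   n <= 8 admits a start such that every third vertex hits all its triangles
   (already with eps = 1). *)
Require Import Defs.
From mathcomp Require Import all_boot all_order all_algebra.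
From mathcomp Require Import all_classical all_reals all_analysis.
From mathcomp Require Import ring lra zify.
Import Order.TTheory GRing.Theory Num.Theory.
Import numFieldNormedType.Exports.
Local Open Scope classical_set_scope.
Local Open Scope ring_scope.
Set Implicit Arguments.
Unset Strict Implicit.
Unset Printing Implicit Defensive.

(** * Crossing numbers of two segments *)

(** Since [polygon] is defined through bounded components, a Jordan theorem for polygonal curves is
    unavoidable. It is used twice: to identify the region with the points of parity 1, and to show
    that a piece of a cut lies in the whole. Pieces are never shown to have disjoint interiors. The
    diagonal is counted once in each piece, so the parities of the pieces add up modulo 2 to that of
    the whole; hence covering is immediate and only inclusion is hard. The start has to be chosen
    before the point to be seen, so the finite check carries, for a whole triangulation, the starts
    that serve all its triangles at once. *)

(** Written in coordinates so that [ring], [lra] and [nra] apply directly; [segmentE] identifies it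
    with [segment]. *)
Definition on_seg (R : realType) (a b x : R * R) : Prop :=
  exists t : R, [/\ 0 <= t <= 1, x.1 = a.1 + t * (b.1 - a.1)
                  & x.2 = a.2 + t * (b.2 - a.2)].

(** Omitting the end [b] makes each vertex belong to the edge that starts there, as in
    [simple_polygonal_curve]. *)
Definition on_hseg (R : realType) (a b x : R * R) : Prop :=
  exists t : R, [/\ 0 <= t < 1, x.1 = a.1 + t * (b.1 - a.1)
                  & x.2 = a.2 + t * (b.2 - a.2)].

Definition cross (R : realType) (a b c : R * R) : R :=
  (b.1 - a.1) * (c.2 - a.2) - (b.2 - a.2) * (c.1 - a.1).

(* Half-open convention: an endpoint level with [q] counts as lying below [q], so
   that a ray through a vertex is counted consistently by its two edges. *)
Definition ray (R : realType) (q a b : R * R) : bool :=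
  ((a.2 <= q.2) != (b.2 <= q.2)) &&
  (if a.2 <= q.2 then 0 < cross a b q else 0 < cross b a q).

(* The leftward ray from [a] meets the segment [q q'], with the same convention. *)
Definition lray (R : realType) (q q' a : R * R) : bool :=
  ((a.2 <= q.2) != (a.2 <= q'.2)) &&
  (if a.2 <= q.2 then cross q' q a < 0 else cross q q' a < 0).

Section FourPoints.
Variable R : realType.
Implicit Types a b c q x y : R * R.

Lemma rayC q a b : ray q a b = ray q b a.
Proof.
rewrite /ray eq_sym.
by case: (a.2 <= q.2); case: (b.2 <= q.2).
Qed.

Lemma crossC a b q : cross b a q = - cross a b q.
Proof. rewrite /cross; ring. Qed.

Lemma cross_meet a b q q' :
  cross a b q' <= 0 <= cross a b q -> cross q q' a <= 0 <= cross q q' b ->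
  cross a b q' < cross a b q ->
  exists x, on_seg a b x /\ on_seg q q' x.
Proof.
have E : cross q q' b - cross q q' a = cross a b q - cross a b q'.
  rewrite /cross; ring.
set A := cross a b q in E *; set A' := cross a b q' in E *.
set C := cross q q' a in E *; set C' := cross q q' b in E *.
move=> /andP[A'0 A0] /andP[C0 C'0] AA.
have D : A - A' != 0 by lra.
(* The meeting point is the zero of an affine function on either segment; by [E] both parameters
   have the same denominator. *)
pose t := A / (A - A').
pose s := - C / (A - A').
exists (q.1 + t * (q'.1 - q.1), q.2 + t * (q'.2 - q.2)); split.
- exists s; split => /=.
  + apply/andP; split; first by rewrite divr_ge0; lra.
    by rewrite ler_pdivrMr; lra.
  + by move: D; rewrite /t /s /A /A' /C /cross => D; field.
  + by move: D; rewrite /t /s /A /A' /C /cross => D; field.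
- exists t; split => //=.
  apply/andP; split; first by rewrite divr_ge0; lra.
  by rewrite ler_pdivrMr; lra.
Qed.

Lemma on_segC a b x : on_seg a b x -> on_seg b a x.
Proof.
move=> [t [/andP[t0 t1] e1 e2]]; exists (1 - t); split; first by apply/andP; lra.
- by rewrite e1; ring.
- by rewrite e2; ring.
Qed.

Lemma lrayC q q' a : lray q q' a = lray q' q a.
Proof.
rewrite /lray eq_sym.
by case: (a.2 <= q.2); case: (a.2 <= q'.2).
Qed.

(** The disjunction amounts to [q'.2 < b.2], spelled out by cases. If the equality failed, the known
    heights would force the signs of the remaining cross products, and [cross_meet] would give a
    common point. *)
Lemma ray_lray_wlog a b q q' :
  ~ (exists x, on_seg a b x /\ on_seg q q' x) -> a.2 <= q.2 -> 
  [|| (a.2 <= q'.2) && (b.2 <= q.2) && ~~ (b.2 <= q'.2)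
    , ~~ (a.2 <= q'.2) && ~~ (b.2 <= q.2) && ~~ (b.2 <= q'.2)
    , (a.2 <= q'.2) && ~~ (b.2 <= q.2) && ~~ (b.2 <= q'.2)
    | ~~ (a.2 <= q'.2) && (b.2 <= q.2) && ~~ (b.2 <= q'.2)] ->
  ray q a b (+) ray q' a b = lray q q' a (+) lray q q' b.
Proof.
move=> nm h1.
have nm1 := fun h1 h2 h3 => nm (@cross_meet a b q q' h1 h2 h3).
have nm2 : cross a b q <= 0 <= cross a b q' -> cross q q' b <= 0 <= cross q q' a ->
  cross a b q < cross a b q' -> False.
  move=> h h2 h3; apply: nm.
  have [||| x [x1 x2]] := @cross_meet b a q q'; rewrite ?(crossC a b) //; try lra.
  by exists x; split => //; apply: on_segC.
rewrite /ray /lray (crossC a b) (crossC q q') (crossC a b) h1.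
have E : cross q q' b - cross q q' a = cross a b q - cross a b q'.
  rewrite /cross; ring.
(* With the names set below, the four points satisfy C' a - C b + A' q - A q' = 0, with coefficients
   of sum zero by [E]. [F1], [F2], [F4] and [F5] are the height coordinate of this dependence after
   eliminating C', A', A and C respectively. *)
have F1 : cross q q' a * (a.2-b.2) + cross a b q' * (q.2-a.2) + cross a b q * (a.2-q'.2) = 0
  by rewrite /cross; ring.
have F2 : cross q q' b * (a.2-q.2) + cross q q' a * (q.2-b.2)+cross a b q *(q.2-q'.2)=0
  by rewrite /cross; ring.
have F4 : cross q q' b * (a.2-q'.2) + cross a b q' * (q.2 - q'.2) + cross q q' a * (q'.2 - b.2) = 0
  by rewrite /cross; ring.
have F5 : cross q q' b * (a.2-b.2) + cross a b q' * (q.2 - b.2) + cross a b q * (b.2 - q'.2) = 0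
  by rewrite /cross; ring.
set A := cross a b q in E F1 F2 F4 F5 nm1 nm2 *; set A' := cross a b q' in E F1 F2 F4 F5 nm1 nm2 *.
set C := cross q q' a in E F1 F2 F4 F5 nm1 nm2 *; set C' := cross q q' b in E F1 F2 F4 F5 nm1 nm2 *.
clear nm.
case: (leP b.2 q.2) => h2; case: (leP a.2 q'.2) => h3; case: (leP b.2 q'.2) => h4 //= _;
  rewrite ?addbF ?addFb ?oppr_gt0 ?oppr_lt0 //.
all: try (apply/esym; match goal with |- (_ (+) _) = false => idtac end).
all: try (apply/negbTE; rewrite negb_add; apply/eqP).
all: apply/idP/idP => H; rewrite ltNge; apply/negP => K.
all: rewrite ?(crossC q q') -/C' ?oppr_lt0 ?oppr_ge0 in H K.
- have s0 : A <= 0 by clear nm1 nm2 E F1 F2 F4; nra.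
  have s1 : 0 <= C by clear nm1 nm2 E F1 F2 F5; nra.
  by clear F1 F2 F4 F5; apply: nm2; try (apply/andP; split); lra.
- have s0 : 0 <= A by clear nm1 nm2 E F1 F2 F4; nra.
  have s1 : C <= 0 by clear nm1 nm2 E F1 F2 F5; nra.
  by clear F1 F2 F4 F5; apply: nm1; try (apply/andP; split); lra.
- have s0 : A <= 0 by clear nm1 nm2 E F1 F4 F5; nra.
  have s1 : 0 <= A' by clear nm1 nm2 E F1 F2 F5; nra.
  by clear F1 F2 F4 F5; apply: nm2; try (apply/andP; split); lra.
- have s0 : 0 <= A by clear nm1 nm2 E F1 F4 F5; nra.
  have s1 : A' <= 0 by clear nm1 nm2 E F1 F2 F5; nra.
  by clear F1 F2 F4 F5; apply: nm1; try (apply/andP; split); lra.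
- have s0 : C <= 0 by clear nm1 nm2 E F2 F4 F5; nra.
  have s1 : 0 <= C' by clear nm1 nm2 E F1 F2 F4; nra.
  by clear F1 F2 F4 F5; apply: nm1; try (apply/andP; split); lra.
- have s0 : 0 <= C by clear nm1 nm2 E F2 F4 F5; nra.
  have s1 : C' <= 0 by clear nm1 nm2 E F1 F2 F4; nra.
  by clear F1 F2 F4 F5; apply: nm2; try (apply/andP; split); lra.
- have s0 : A' <= 0 by clear nm1 nm2 E F2 F4 F5; nra.
  have s1 : 0 <= C' by clear nm1 nm2 E F1 F4 F5; nra.
  by clear F1 F2 F4 F5; apply: nm1; try (apply/andP; split); lra.
- have s0 : 0 <= A' by clear nm1 nm2 E F2 F4 F5; nra.
  have s1 : C' <= 0 by clear nm1 nm2 E F1 F4 F5; nra.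
  by clear F1 F2 F4 F5; apply: nm2; try (apply/andP; split); lra.
Qed.

(** The rightward rays from the points of [q q'] sweep a strip bounded by the two extreme rays and
    by [q q'], and [lray q q'] tests membership in it. A segment missing [q q'] changes membership
    exactly when it crosses one of the two rays but not the other. Exchanging the ends of either
    segment reduces to [ray_lray_wlog]; the other height patterns are trivial or contradictory. *)
Lemma ray_lray a b q q' : ~ (exists x, on_seg a b x /\ on_seg q q' x) ->
  ray q a b (+) ray q' a b = lray q q' a (+) lray q q' b.
Proof.
move=> nm.
have nm1 : ~ (exists x, on_seg b a x /\ on_seg q q' x).
  by move=> [x [/on_segC h1 h2]]; apply: nm; exists x.
have nm2 : ~ (exists x, on_seg a b x /\ on_seg q' q x).
  by move=> [x [h1 /on_segC h2]]; apply: nm; exists x.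
have nm3 : ~ (exists x, on_seg b a x /\ on_seg q' q x).
  by move=> [x [h1 /on_segC h2]]; apply: nm1; exists x.
have := ray_lray_wlog nm; have := ray_lray_wlog nm1.
have := ray_lray_wlog nm2; have := ray_lray_wlog nm3.
rewrite !(rayC _ b a) !(lrayC q' q) (addbC (ray q' a b)) (addbC (lray q q' b)).
case h1 : (a.2 <= q.2); case h2 : (b.2 <= q.2);
  case h3 : (a.2 <= q'.2); case h4 : (b.2 <= q'.2);
  try (by move=> H1 H2 H3 H4; auto); move=> _ _ _ _;
  rewrite /ray /lray h1 h2 h3 h4 //=.
all: exfalso; move: h1 h2 h3 h4; do 4 case: leP => // ?; lra.
Qed.

End FourPoints.

(** * Cyclic sequences and simple closed curves *)

(** Curves become cyclic lists of vertices, because a cut along a diagonal splits such a list into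
    two that share the ends of the cut. *)
Fixpoint pedges (T : Type) (x : T) (s : seq T) : seq (T * T) :=
  if s is y :: s' then (x, y) :: pedges y s' else [::].

Definition edges (T : Type) (l : seq T) : seq (T * T) :=
  if l is x :: s then pedges x (rcons s x) else [::].

Section Edges.
Variable T : eqType.
Implicit Types (x y z : T) (s l : seq T).

Lemma pedges_cat x s1 s2 :
  pedges x (s1 ++ s2) = pedges x s1 ++ pedges (last x s1) s2.
Proof. by elim: s1 x => //= y s1 IH x; rewrite IH. Qed.

Lemma unzip1_pedges x s y : unzip1 (pedges x (rcons s y)) = x :: s.
Proof. by elim: s x => //= z s IH x; rewrite -IH. Qed.

Lemma unzip2_pedges x s : unzip2 (pedges x s) = s.
Proof. by elim: s x => //= z s IH x; rewrite IH. Qed.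

Lemma unzip1_edges l : unzip1 (edges l) = l.
Proof. by case: l => //= x s; rewrite unzip1_pedges. Qed.

Lemma unzip2_edges l : unzip2 (edges l) = rot 1 l.
Proof. by case: l => //= x s; rewrite unzip2_pedges rot1_cons. Qed.

Lemma edges_cat x s1 z s2 :
  edges (x :: s1 ++ z :: s2) = pedges x (rcons s1 z) ++ pedges z (rcons s2 x).
Proof.
by rewrite /edges rcons_cat rcons_cons -cat_rcons pedges_cat last_rcons.
Qed.

Lemma edges_rot k l : perm_eq (edges (rot k l)) (edges l).
Proof.
have [kl|kl] := leqP (size l) k; first by rewrite rot_oversize.
case: k kl => [|k] kl; first by rewrite rot0.
case: l kl => // x s; rewrite ltnS => kl.
rewrite -{2}(cat_take_drop k.+1 (x :: s)) /rot.
have : (0 < size (drop k.+1 (x :: s)))%N by rewrite size_drop subn_gt0 ltnS.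
case: (drop _ _) => // z s2 _ /=.
by rewrite !rcons_cat !rcons_cons -!cat_rcons !pedges_cat !last_rcons perm_catC.
Qed.

Lemma edgesP l a b : (a, b) \in edges l -> a \in l /\ b \in l.
Proof.
move=> ab; split.
- by rewrite -(unzip1_edges l); apply/mapP; exists (a, b).
- by rewrite -(mem_rot 1) -unzip2_edges; apply/mapP; exists (a, b).
Qed.

Lemma edges_next l a : a \in l -> exists b, (a, b) \in edges l.
Proof.
rewrite -{1}(unzip1_edges l) => /mapP[[c d] cd /= ->].
by exists d.
Qed.

Lemma edges_prev l b : b \in l -> exists a, (a, b) \in edges l.
Proof.
rewrite -(mem_rot 1) -{1}(unzip2_edges l) => /mapP[[c d] cd /= ->].
by exists c.
Qed.

Lemma uniq_map_in (U : eqType) (f : T -> U) s :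
  uniq (map f s) -> {in s &, injective f}.
Proof.
elim: s => //= x s IH /andP[xs us] a b.
rewrite !inE => /orP[/eqP->|ia] /orP[/eqP->|ib] //; last by apply: IH.
- by move=> e; move: xs; rewrite e map_f.
- by move=> e; move: xs; rewrite -e map_f.
Qed.

End Edges.

Lemma edges_inj1 (T : eqType) (l : seq T) a b c : uniq l ->
  (a, b) \in edges l -> (a, c) \in edges l -> b = c.
Proof.
rewrite -{1}(unzip1_edges l) => /uniq_map_in h ab ac.
by have [] := h _ _ ab ac erefl.
Qed.

Lemma edges_inj2 (T : eqType) (l : seq T) a b c : uniq l ->
  (a, c) \in edges l -> (b, c) \in edges l -> a = b.
Proof.
rewrite -(rot_uniq 1) -{1}(unzip2_edges l) => /uniq_map_in h ab ac.
by have [] := h _ _ ab ac erefl.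
Qed.

Section Curve.
Variable R : realType.
Implicit Types (a b c d q x y : R * R) (l : seq (R * R)).

Definition on_curve l x := exists a b, (a, b) \in edges l /\ on_seg a b x.

Definition par l q := \big[addb/false]_(e <- edges l) ray q e.1 e.2.

Definition simple l := [/\ uniq l, (2 < size l)%N &
  forall a b c d x, (a, b) \in edges l -> (c, d) \in edges l ->
    on_hseg a b x -> on_hseg c d x -> (a, b) = (c, d)].

Lemma on_curve_rot k l x : on_curve (rot k l) x <-> on_curve l x.
Proof.
by split=> [] [a [b [ab h]]]; exists a, b; split => //;
  rewrite ?(perm_mem (edges_rot k l)) // -(perm_mem (edges_rot k l)).
Qed.

Lemma par_rot k l q : par (rot k l) q = par l q.
Proof. by rewrite /par (perm_big _ (edges_rot k l)). Qed.

Lemma simple_rot k l : simple l -> simple (rot k l).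
Proof.
move=> [u s h]; split; rewrite ?rot_uniq ?size_rot //.
by move=> a b c d x; rewrite !(perm_mem (edges_rot k l)); apply: h.
Qed.

(** Every vertex occurs once as the start and once as the end of an edge. *)
Lemma telescope_edges (g : R * R -> bool) l :
  \big[addb/false]_(e <- edges l) (g e.1 (+) g e.2) = false.
Proof.
rewrite big_split /= -(big_map fst xpredT g) -(big_map snd xpredT g).
rewrite -/(unzip1 _) -/(unzip2 _) unzip1_edges unzip2_edges.
have -> : \big[addb/false]_(i <- rot 1 l) g i = \big[addb/false]_(i <- l) g i.
  by apply: perm_big; rewrite perm_rot.
exact: addbb.
Qed.

(* [lray q q' a] telescopes around the polygon, so only the curve crossing
   [q q'] can change the parity. *)
Lemma par_seg l q q' : ~ (exists x, on_curve l x /\ on_seg q q' x) ->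
  par l q = par l q'.
Proof.
move=> h; apply/eqP; rewrite -negb_add; apply/negPf; rewrite /par -big_split /=.
rewrite -[RHS](telescope_edges (lray q q') l); apply: eq_big_seq => -[a b] ab /=.
by apply: ray_lray => -[x [x1 x2]]; apply: h; exists x; split => //; exists a, b.
Qed.

Lemma on_hsegW a b x : on_hseg a b x -> on_seg a b x.
Proof.
by move=> [t [/andP[t0 t1] e1 e2]]; exists t; split => //; rewrite t0 ltW.
Qed.

Lemma on_segE a b x : on_seg a b x -> on_hseg a b x \/ x = b.
Proof.
move=> [t [/andP[t0 t1] e1 e2]]; have [t1'|t1'] := ltP t 1.
  by left; exists t; rewrite t0.
have ? : t = 1 by apply/eqP; rewrite eq_le t1.
right; rewrite (surjective_pairing x) (surjective_pairing b) e1 e2; congr pair;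
  subst t; ring.
Qed.

Lemma on_hsegl a b : on_hseg a b a.
Proof. by exists 0; split; [rewrite lexx ltr01|ring|ring]. Qed.

Lemma on_segl a b : on_seg a b a.
Proof. exact/on_hsegW/on_hsegl. Qed.

Lemma on_segr a b : on_seg a b b.
Proof. exact/on_segC/on_segl. Qed.

(** Distinct edges share at most a vertex at which one follows the other: a point at the closed end
    of an edge is also the start of the next one, where injectivity on half-open edges applies. *)
Lemma simple_touch l a b c d x : simple l -> (a, b) \in edges l ->
  (c, d) \in edges l -> (a, b) <> (c, d) -> on_seg a b x -> on_seg c d x ->
  (x = b /\ x = c) \/ (x = a /\ x = d).
Proof.
move=> [u _ h] ab cd ne /on_segE[h1|e1] /on_segE[h2|e2].
- by case: ne; apply: h h1 h2.
- have [_ dl] := edgesP cd; have [e de] := edges_next dl.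
  rewrite -e2 in de; have [xa _] := h _ _ _ _ x ab de h1 (on_hsegl _ _).
  by right.
- have [_ bl] := edgesP ab; have [e be] := edges_next bl.
  rewrite -e1 in be; have [xc _] := h _ _ _ _ x be cd (on_hsegl _ _) h2.
  by left.
- by case: ne; subst b d; rewrite (edges_inj2 u ab cd).
Qed.

Lemma simple_neq l a b : simple l -> (a, b) \in edges l -> a <> b.
Proof.
move=> [u sz _] ab e; subst b.
have [al _] := edgesP ab; have [k s e] := rot_to al.
move: u sz ab; rewrite -(rot_uniq k) -(size_rot k) -(perm_mem (edges_rot k l)) e.
case: s {e} => // y s u _ ab.
have ay : (a, y) \in edges (a :: y :: s) by rewrite mem_head.
by move: (u); rewrite -(edges_inj1 u ab ay) /= mem_head.
Qed.

End Curve.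

(** * Boxes, joined points and local constancy of the parity *)

Definition box (R : realType) (x : R * R) (e : R) (y : R * R) : Prop :=
  [/\ x.1 - e < y.1 < x.1 + e & x.2 - e < y.2 < x.2 + e].

(** Polygonal paths avoiding [K] replace topological connectedness, because [par_seg] carries the
    parity along each of their segments. *)
Inductive joined (R : realType) (K : set (R * R)) (x : R * R) : R * R -> Prop :=
| joined_refl : joined K x x
| joined_step y z : joined K x y -> (forall w, on_seg y z w -> ~ K w) ->
    joined K x z.

Section Local.
Variable R : realType.
Implicit Types (a b c d q x y v w u : R * R) (l : seq (R * R)) (K : set (R * R)).

Definition pt_on a b (t : R) : R * R := (a.1 + t * (b.1 - a.1), a.2 + t * (b.2 - a.2)).

Lemma on_seg_pt a b (t : R) : 0 <= t <= 1 -> on_seg a b (pt_on a b t).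
Proof. by exists t. Qed.

Lemma on_seg_image a b : (on_seg a b : set (R * R)) = pt_on a b @` `[0, 1].
Proof.
apply/seteqP; split => [x [t [t01 e1 e2]]|x [t /= t01 <-]].
  exists t; first by rewrite /= in_itv.
  by rewrite (surjective_pairing x) e1 e2.
by move: t01; rewrite in_itv /= => t01; exists t.
Qed.

Lemma pt_on_continuous a b : continuous (pt_on a b).
Proof.
move=> t; have c (r r' : R) : r + s * (r' - r) @[s --> t] --> r + t * (r' - r).
  by apply: cvgD; [exact: cvg_cst|apply: cvgM; [exact: cvg_id|exact: cvg_cst]].
exact: (cvg_pair (c a.1 b.1) (c a.2 b.2)).
Qed.

Lemma on_seg_closed a b : closed (on_seg a b : set (R * R)).
Proof.
rewrite on_seg_image; apply: compact_closed; first exact: norm_hausdorff.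
apply: continuous_compact; last exact: segment_compact.
by apply: continuous_subspaceT; exact: pt_on_continuous.
Qed.

Lemma box_open (K : set (R * R)) x : closed K -> ~ K x ->
  exists2 e, 0 < e & forall y, box x e y -> ~ K y.
Proof.
move=> cK nK.
have : nbhs x (~` K) by apply: open_nbhs_nbhs; split => //; exact: closed_openC.
move=> /nbhs_ballP[e /= e0 h]; exists e => // y [y1 y2]; apply: h.
by split; rewrite /ball /= ltr_distlC; lra.
Qed.

Lemma box_sub x e e' y : e <= e' -> box x e y -> box x e' y.
Proof. by move=> ee [/andP[? ?] /andP[? ?]]; split; apply/andP; split; lra. Qed.

Lemma box_center x e : 0 < e -> box x e x.
Proof. by move=> e0; split; apply/andP; split; lra. Qed.

Lemma box_half x y e z : box x (e / 2) y -> box y (e / 2) z -> box x e z.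
Proof.
by move=> [/andP[? ?] /andP[? ?]] [/andP[? ?] /andP[? ?]]; split; apply/andP; split; lra.
Qed.

Lemma conv_gt (r y z t : R) : 0 <= t <= 1 -> r < y -> r < z -> r < y + t * (z - y).
Proof.
move=> /andP[]; rewrite le_eqVlt => /orP[/eqP <-|t0] t1 ry rz; first by lra.
by have : 0 <= (1 - t) * (y - r) by [rewrite mulr_ge0; lra];
   have : 0 < t * (z - r) by [rewrite mulr_gt0; lra]; lra.
Qed.

Lemma conv_lt (r y z t : R) : 0 <= t <= 1 -> y < r -> z < r -> y + t * (z - y) < r.
Proof.
move=> t01 yr zr; have := @conv_gt (- r) (- y) (- z) t t01; rewrite !ltrN2.
by move=> /(_ yr zr); lra.
Qed.

Lemma box_convex x e y z w : box x e y -> box x e z -> on_seg y z w -> box x e w.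
Proof.
move=> [/andP[? ?] /andP[? ?]] [/andP[? ?] /andP[? ?]] [t [t01 e1 e2]].
by split; rewrite ?e1 ?e2; apply/andP; split; (exact: conv_gt || exact: conv_lt).
Qed.

Lemma box_off_segs (es : seq ((R * R) * (R * R))) x :
  (forall a b, (a, b) \in es -> ~ on_seg a b x) ->
  exists2 e, 0 < e & forall y a b, box x e y -> (a, b) \in es -> ~ on_seg a b y.
Proof.
elim: es => [|[a b] es IH] h; first by exists 1.
have [|e1 e10 h1] := IH.
  by move=> c d cd; apply: h; rewrite inE cd orbT.
have [|e2 e20 h2] := @box_open _ x (@on_seg_closed a b).
  by apply: h; rewrite inE eqxx.
exists (Num.min e1 e2); first by rewrite lt_min e10.
move=> y c d xy; rewrite inE => /orP[/eqP[-> ->]|cd].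
- by apply: h2; apply: box_sub xy; rewrite ge_min lexx orbT.
- by apply: h1 cd; apply: box_sub xy; rewrite ge_min lexx.
Qed.

Lemma box_off_curve l x : ~ on_curve l x ->
  exists2 e, 0 < e & forall y, box x e y -> ~ on_curve l y.
Proof.
move=> nx; have [|e e0 h] := @box_off_segs (edges l) x.
  by move=> a b ab abx; apply: nx; exists a, b.
by exists e => // y xy [a [b [ab aby]]]; apply: h xy ab aby.
Qed.

(** Induction along the interval: the supremum of those t for which [P] holds on all of [0, t] has a
    neighbourhood on which [P] spreads, so it cannot stay below 1. *)
Lemma unit_interval_ind (P : R -> Prop) :
  (forall t, 0 <= t <= 1 -> exists2 e, 0 < e &
     forall s s', 0 <= s <= 1 -> 0 <= s' <= 1 ->
       t - e < s < t + e -> t - e < s' < t + e -> P s -> P s') ->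
  P 0 -> forall t, 0 <= t <= 1 -> P t.
Proof.
move=> loc P0.
pose S := [set t : R | 0 <= t <= 1 /\ forall s, 0 <= s <= t -> P s].
have S0 : S 0.
  by split=> [|s]; [rewrite lexx ler01|rewrite -eq_le => /eqP <-].
have S1 : ubound S 1 by move=> t [/andP[]].
have hS : has_sup S by split; [exists 0|exists 1].
have t0 : 0 <= sup S by apply: ub_le_sup => //; exists 1.
have t1 : sup S <= 1 by apply: ge_sup => //; exists 0.
have [|e e0 he] := loc (sup S); first by rewrite t0.
have [s [/andP[s0 s1] sP] ss] := sup_adherent e0 hS.
have ss' : s <= sup S.
  by apply: ub_le_sup; [exists 1|split=> //; rewrite s0].
have S2 : S (Num.min 1 (sup S + e / 2)).
  split.
    by rewrite le_min ler01 ge_min lexx /= andbT; lra.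
  move=> r /andP[r0]; rewrite le_min => /andP[r1 r2].
  have [rs|sr] := leP r s; first by apply: sP; rewrite r0.
  by apply: (he s) => //; rewrite ?s0 ?r0 //; try (apply/andP; split); try lra;
    apply: sP; rewrite s0 lexx.
have : Num.min 1 (sup S + e / 2) <= sup S by apply: ub_le_sup => //; exists 1.
rewrite ge_min => /orP[h1|]; last by lra.
move: S2; rewrite min_l => [[_ h2] t /andP[t2 t3]|]; last by lra.
by apply: h2; rewrite t2.
Qed.

Lemma joined_trans K x y z : joined K x y -> joined K y z -> joined K x z.
Proof. by move=> xy; elim=> // y' z' _ h yz; apply: joined_step yz. Qed.

Lemma joined_seg K y z : (forall w, on_seg y z w -> ~ K w) -> joined K y z.
Proof. by move=> h; apply: joined_step h; apply: joined_refl. Qed.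

Lemma joined_sym K x y : joined K x y -> joined K y x.
Proof.
elim=> [|y' z _ h yz]; first exact: joined_refl.
by apply: joined_trans h; apply: joined_seg => w /on_segC /yz.
Qed.

Lemma joined_off K x y : joined K x y -> ~ K x -> ~ K y.
Proof. by case=> // y' z _ h _; apply: h; apply: on_segr. Qed.

Lemma par_joined l x y : joined (on_curve l) x y -> par l x = par l y.
Proof.
elim=> // y' z _ -> h; apply: par_seg => -[w [w1 w2]]; exact: h w2 w1.
Qed.

Lemma edges_uniq l : uniq l -> uniq (edges l).
Proof. by rewrite -{1}(unzip1_edges l); apply: map_uniq. Qed.

(** In the telescoped sum every other edge contributes nothing by [ray_lray], so the parity changes
    exactly when the identity of [ray_lray] fails for [a b]. *)
Lemma par_cross l a b q q' : uniq l -> (a, b) \in edges l ->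
  (forall c d x, (c, d) \in edges l -> (c, d) <> (a, b) -> on_seg q q' x ->
     ~ on_seg c d x) ->
  ray q a b (+) ray q' a b != lray q q' a (+) lray q q' b ->
  par l q != par l q'.
Proof.
move=> u ab off X.
pose g (e : (R * R) * (R * R)) := (ray q e.1 e.2 (+) ray q' e.1 e.2) (+)
  (lray q q' e.1 (+) lray q q' e.2).
have -> : (par l q != par l q') = \big[addb/false]_(e <- edges l) g e.
  by rewrite /g big_split /= (telescope_edges (lray q q')) addbF big_split negb_eqb.
rewrite (bigD1_seq (a, b)) ?edges_uniq //= big_seq_cond big1.
  by rewrite addbF /g /= -negb_eqb.
move=> [c d] /andP[cd /eqP ne]; rewrite /g /= ray_lray ?addbb //.
by move=> [x [x1 x2]]; apply: (off c d x).
Qed.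

End Local.

Section Jordan.
Variable R : realType.
Implicit Types (a b c d q x y v w u : R * R) (l : seq (R * R)).

Lemma simple_off_edge l a b c d (t : R) : simple l -> (a, b) \in edges l ->
  0 < t < 1 -> (c, d) \in edges l -> on_seg c d (pt_on a b t) -> (c, d) = (a, b).
Proof.
move=> sl ab /andP[t0 t1] cd h; have [//|/eqP ne] := eqVneq (c, d) (a, b).
have ne' : (a, b) <> (c, d) by move=> e; apply: ne.
have nab := simple_neq sl ab.
have m : on_seg a b (pt_on a b t) by apply: on_seg_pt; lra.
have := simple_touch sl ab cd ne' m h.
case: (a) (b) nab => a1 a2 [b1 b2] nab; rewrite /pt_on /=.
by case=> [] [[e1 e2] _]; case: nab; congr pair; nra.
Qed.

(* Across an edge the parity flips: shift [m] horizontally, or vertically when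
   the edge is horizontal, so that only one of the four terms of the crossing
   count survives. *)
Lemma flip_edge l a b (t e : R) : simple l -> (a, b) \in edges l ->
  0 < t < 1 -> 0 < e ->
  exists y y', [/\ box (pt_on a b t) e y, box (pt_on a b t) e y',
    ~ on_curve l y, ~ on_curve l y' & par l y != par l y'].
Proof.
move=> sl ab t01 e0; have [ul _ _] := sl.
set m := pt_on a b t.
have [|r r0 hr] := @box_off_segs R [seq e <- edges l | e != (a, b)] m.
  move=> c d; rewrite mem_filter => /andP[/eqP ne cd] h; apply: ne.
  exact: (simple_off_edge sl ab t01 cd h).
pose k := Num.min r e / 2.
have k0 : 0 < k by rewrite divr_gt0 // lt_min r0.
have mr : Num.min r e <= r by rewrite ge_min lexx.
have me : Num.min r e <= e by rewrite ge_min lexx orbT.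
have kr : k < r by rewrite /k; lra.
have ke : k < e by rewrite /k; lra.
pose hz := a.2 == b.2.
pose y := if hz then (m.1, m.2 + k) else (m.1 - k, m.2).
pose y' := if hz then (m.1, m.2 - k) else (m.1 + k, m.2).
have by_ g : k < g -> box m g y.
  by move=> kg; rewrite /y; case: (hz); split => /=; apply/andP; split; lra.
have by_' g : k < g -> box m g y'.
  by move=> kg; rewrite /y'; case: (hz); split => /=; apply/andP; split; lra.
have nab := simple_neq sl ab.
have off1 c d : (c, d) \in edges l -> (c, d) <> (a, b) -> forall x,
  on_seg y y' x -> ~ on_seg c d x.
  move=> cd ne x xyy; apply: (hr x); last by rewrite mem_filter cd andbT; apply/eqP.
  by apply: box_convex xyy; [apply: by_|apply: by_'].
have nab' : a.1 != b.1 \/ a.2 != b.2.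
  apply/orP; rewrite -negb_and; apply/negP => /andP[/eqP e1 /eqP e2]; apply: nab.
  by rewrite (surjective_pairing a) (surjective_pairing b) e1 e2.
have /andP[t0 t1] := t01.
have offab z : z = y \/ z = y' -> ~ on_seg a b z.
  move=> hz' [s [/andP[s0 s1]]]; case: hz' => ->; rewrite /y /y'; move: nab';
   rewrite /hz /m /pt_on; case: (eqVneq a.2 b.2) => //= h nab'.
  - by move=> _; nra.
  - move=> e1 e2; have st : s = t by have : (s - t) * (b.2 - a.2) = 0; nra.
    by subst s; lra.
  - by move=> _; nra.
  - move=> e1 e2; have st : s = t by have : (s - t) * (b.2 - a.2) = 0; nra.
    by subst s; lra.
have off z : z = y \/ z = y' -> ~ on_curve l z.
  move=> hz' [c [d [cd h]]]; have [[ec ed]|/eqP ne] := eqVneq (c, d) (a, b).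
    by subst c d; apply: offab hz' h.
  apply: (off1 c d cd ne z) => //.
  by case: hz' => ->; [exact: on_segl|exact: on_segr].
exists y, y'; split; try (exact: by_ || exact: by_'); try (apply: off; auto).
apply: (par_cross ul ab); first by move=> c d x cd ne; apply: off1.
have m1 : m.1 = a.1 + t * (b.1 - a.1) by [].
have m2 : m.2 = a.2 + t * (b.2 - a.2) by [].
clearbody m.
rewrite /y /y'; move: nab'; rewrite /hz; case: (eqVneq a.2 b.2) => h nab'.
- have em : m.2 = a.2 by rewrite m2 -h; ring.
  have crossE z : z.2 = a.2 ->
      (cross (m.1, m.2 - k) (m.1, m.2 + k) z < 0) = (m.1 < z.1).
    by move=> ez; rewrite /cross /=; apply/idP/idP => ?; nra.
  rewrite /ray /lray /= !crossE -?h //.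
  have -> : a.2 <= m.2 + k by lra.
  have -> : (a.2 <= m.2 - k) = false by apply/negbTE; rewrite -ltNge; lra.
  rewrite /=; case: nab' => [|/eqP//]; rewrite neq_lt => /orP[ab1|ab1].
  + have -> : m.1 < b.1 by rewrite ?m1 ?m2; nra.
    have -> // : (m.1 < a.1) = false.
    by apply/negbTE; rewrite -leNgt m1; nra.
  + have -> : m.1 < a.1 by rewrite ?m1 ?m2; nra.
    have -> // : (m.1 < b.1) = false.
    by apply/negbTE; rewrite -leNgt m1; nra.
- have E g : cross a b (m.1 + g, m.2) = - g * (b.2 - a.2).
    rewrite /cross /= m1 m2; ring.
  have E' g : cross b a (m.1 + g, m.2) = g * (b.2 - a.2).
    rewrite /cross /= m1 m2; ring.
  rewrite /ray /lray /= !eqxx /= !E !E'; move: h; rewrite neq_lt => /orP[ab2|ab2].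
  + have -> : a.2 <= m.2 by rewrite ?m1 ?m2; nra.
    have -> : (b.2 <= m.2) = false.
      by apply/negbTE; rewrite -ltNge m2; nra.
    rewrite /=; have -> : 0 < - - k * (b.2 - a.2) by nra.
    by have -> // : (0 < - k * (b.2 - a.2)) = false by apply/negbTE; rewrite -leNgt; nra.
  + have -> : b.2 <= m.2 by rewrite ?m1 ?m2; nra.
    have -> : (a.2 <= m.2) = false.
      by apply/negbTE; rewrite -ltNge m2; nra.
    rewrite /=; have -> : 0 < - k * (b.2 - a.2) by nra.
    by have -> // : (0 < k * (b.2 - a.2)) = false by apply/negbTE; rewrite -leNgt; nra.
Qed.

Lemma small_step v (d : R * R) (e : R) : 0 < e -> exists2 r : R, 0 < r <= 1 &
  forall t, 0 <= t <= r -> box v e (v.1 + t * d.1, v.2 + t * d.2).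
Proof.
move=> e0; pose D := 1 + `|d.1| + `|d.2| + e.
have D0 : 0 < D by rewrite /D; have := normr_ge0 d.1; have := normr_ge0 d.2; lra.
exists (e / D).
  rewrite divr_gt0 //= ler_pdivrMr // mul1r /D.
  by have := normr_ge0 d.1; have := normr_ge0 d.2; lra.
move=> t /andP[t0]; rewrite ler_pdivlMr // => tD.
have [n1 n2] := (normr_ge0 d.1, normr_ge0 d.2).
have k1 : `|t * d.1| < e.
  by rewrite normrM (ger0_norm t0); rewrite /D in tD; nra.
have k2 : `|t * d.2| < e.
  by rewrite normrM (ger0_norm t0); rewrite /D in tD; nra.
by move: k1 k2; rewrite !ltr_norml => /andP[? ?] /andP[? ?];
  split; apply/andP; split => /=; lra.
Qed.

End Jordan.

(** * The curve near one of its points *)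

Section Germs.
Variable R : realType.
Implicit Types (a b c d q x y v w u : R * R) (l : seq (R * R)).

Lemma flip_near l x (e : R) : simple l -> on_curve l x -> 0 < e ->
  exists y y', [/\ box x e y, box x e y',
    ~ on_curve l y, ~ on_curve l y' & par l y != par l y'].
Proof.
move=> sl [a [b [ab [t [/andP[t0 t1] e1 e2]]]]] e0.
have e20 : 0 < e / 2 by rewrite divr_gt0.
suff [s s01 h] : exists2 s, 0 < s < 1 & box x (e / 2) (pt_on a b s).
  have [y [y' [h1 h2 o o' p]]] := flip_edge sl ab s01 e20.
  by exists y, y'; split => //; [exact: box_half h h1|exact: box_half h h2].
(* Moving from [x] towards the farther end of the edge gives a parameter strictly inside the unit
   interval, even when [x] is a vertex. *)
have [st|st] := leP t (1/2%:R).
- have [r /andP[r0 r1] hr] := small_step x (b.1 - a.1, b.2 - a.2) e20.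
  exists (t + r / 4%:R); first by apply/andP; split; lra.
  have -> : pt_on a b (t + r / 4%:R) = (x.1 + r / 4%:R * (b.1 - a.1), x.2 + r / 4%:R * (b.2 - a.2)).
    by rewrite /pt_on e1 e2; congr pair; ring.
  by apply: hr; apply/andP; split; lra.
- have [r /andP[r0 r1] hr] := small_step x (a.1 - b.1, a.2 - b.2) e20.
  exists (t - r / 4%:R); first by apply/andP; split; lra.
  have -> : pt_on a b (t - r / 4%:R) = (x.1 + r / 4%:R * (a.1 - b.1), x.2 + r / 4%:R * (a.2 - b.2)).
    by rewrite /pt_on e1 e2; congr pair; ring.
  by apply: hr; apply/andP; split; lra.
Qed.


(** If [x] were beyond [w] on the ray from [v], convexity would put [w] into the box. *)
Lemma ray_box v w x (e s : R) : 0 < e -> ~ box v e w -> box v e x -> 0 <= s ->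
  x.1 = v.1 + s * (w.1 - v.1) -> x.2 = v.2 + s * (w.2 - v.2) -> on_seg v w x.
Proof.
move=> e0 nw bx s0 e1 e2; have [s1|s1] := leP s 1.
  by exists s; rewrite s0.
case: nw; apply: box_convex (box_center _ e0) bx _.
have sn : s != 0 by rewrite gt_eqF; lra.
exists s^-1; split.
- by rewrite invr_ge0 s0 invf_le1 ?ltW //; lra.
- by rewrite e1; field.
- by rewrite e2; field.
Qed.

Lemma cross_affine1 v u y y' z (t : R) : z.1 = y.1 + t * (y'.1 - y.1) ->
  z.2 = y.2 + t * (y'.2 - y.2) ->
  cross v z u = cross v y u + t * (cross v y' u - cross v y u).
Proof. by rewrite /cross => -> ->; ring. Qed.

Lemma cross_affine2 v u y y' z (t : R) : z.1 = y.1 + t * (y'.1 - y.1) ->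
  z.2 = y.2 + t * (y'.2 - y.2) ->
  cross v u z = cross v u y + t * (cross v u y' - cross v u y).
Proof. by rewrite /cross => -> ->; ring. Qed.

(** Cramer's rule: up to the factor [cross v w u], the two cross products are the coordinates of
    [x - v] in the basis [w - v], [u - v]. *)
Lemma cross_coord v w u x : cross v w u != 0 ->
  x.1 = v.1 + cross v x u / cross v w u * (w.1 - v.1) +
        cross v w x / cross v w u * (u.1 - v.1) /\
  x.2 = v.2 + cross v x u / cross v w u * (w.2 - v.2) +
        cross v w x / cross v w u * (u.2 - v.2).
Proof. by rewrite /cross => k; split; field. Qed.

(** Both arms leave the box, so inside it they look like full rays from [v]. *)
Definition corner (K : set (R * R)) v u w (e : R) := [/\ 0 < e,
  forall x, box v e x -> K x <-> on_seg v u x \/ on_seg v w x,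
  ~ box v e u & ~ box v e w].

Lemma cornerC K v u w e : corner K v u w e -> corner K v w u e.
Proof. by move=> [? h ? ?]; split => // x /h ->; split; case; auto. Qed.

Section ConvexCorner.
Variables (K : set (R * R)) (v u w : R * R) (e : R).
Hypothesis (hK : corner K v u w e) (k0 : 0 < cross v w u).

Lemma corner_K_ge0 x : box v e x -> K x ->
  [/\ 0 <= cross v x u, 0 <= cross v w x & ~ (0 < cross v x u /\ 0 < cross v w x)].
Proof.
have [_ h _ _] := hK.
move=> bx /(h x bx)[] [t [/andP[t0 t1] e1 e2]].
- have -> : cross v x u = 0 by rewrite /cross e1 e2; ring.
  have -> : cross v w x = t * cross v w u by rewrite /cross e1 e2; ring.
  by split; [|rewrite mulr_ge0 // ltW|case; rewrite ltxx].
- have -> : cross v w x = 0 by rewrite /cross e1 e2; ring.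
  have -> : cross v x u = t * cross v w u by rewrite /cross e1 e2; ring.
  by split; [rewrite mulr_ge0 // ltW| |case=> _; rewrite ltxx].
Qed.

Lemma corner_off x : box v e x -> ~ K x ->
  (0 < cross v x u /\ 0 < cross v w x) \/ (cross v x u < 0 \/ cross v w x < 0).
Proof.
have [e0 h nu nw] := hK; move=> bx nK.
have kn : cross v w u != 0 by rewrite gt_eqF.
have [c1 c2] := cross_coord x kn.
have [|A0] := ltP (cross v x u) 0; first by auto.
have [|B0] := ltP (cross v w x) 0; first by auto.
left; split; rewrite lt_neqAle ?A0 ?B0 andbT eq_sym; apply/eqP => E; apply: nK;
  apply/(h x bx); rewrite E !mul0r ?add0r ?addr0 in c1 c2.
- left; apply: (@ray_box v u x e (cross v w x / cross v w u)) => //.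
  by rewrite divr_ge0 // ltW.
- right; apply: (@ray_box v w x e (cross v x u / cross v w u)) => //.
  by rewrite divr_ge0 // ltW.
Qed.

Lemma corner_in_joined y y' : box v e y -> box v e y' ->
  0 < cross v y u -> 0 < cross v w y -> 0 < cross v y' u -> 0 < cross v w y' ->
  joined K y y'.
Proof.
move=> by_ by' a1 b1 a2 b2; apply: joined_seg => z sz Kz.
have [_ _ []] := corner_K_ge0 (box_convex by_ by' sz) Kz.
case: sz => t [t01 e1 e2].
rewrite (cross_affine1 v u e1 e2) (cross_affine2 v w e1 e2).
by split; apply: conv_gt.
Qed.

(** The outside of the cone is not convex, but it is the union of two open half-planes; the point
    [c] opposite to the cone lies in both and connects them. *)
Lemma corner_out_joined y y' : box v e y -> box v e y' ->
  cross v y u < 0 \/ cross v w y < 0 -> cross v y' u < 0 \/ cross v w y' < 0 ->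
  joined K y y'.
Proof.
have [e0 _ _ _] := hK.
have [r /andP[r0 r1] hr] := small_step v (2%:R * v.1 - u.1 - w.1, 2%:R * v.2 - u.2 - w.2) e0.
set c : R * R := (v.1 + r * (2%:R * v.1 - u.1 - w.1), v.2 + r * (2%:R * v.2 - u.2 - w.2)).
have bc : box v e c by apply: hr; rewrite lexx ltW.
have Ac : cross v c u = - r * cross v w u by rewrite /cross /c /=; ring.
have Bc : cross v w c = - r * cross v w u by rewrite /cross /c /=; ring.
have rk : 0 < r * cross v w u by rewrite mulr_gt0.
have side1 y1 y2 : box v e y1 -> box v e y2 -> cross v y1 u < 0 -> cross v y2 u < 0 ->
    joined K y1 y2.
  move=> b1 b2 s1 s2; apply: joined_seg => z sz Kz.
  have [] := corner_K_ge0 (box_convex b1 b2 sz) Kz.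
  case: sz => t [t01 e1 e2]; rewrite (cross_affine1 v u e1 e2) leNgt.
  by rewrite conv_lt.
have side2 y1 y2 : box v e y1 -> box v e y2 -> cross v w y1 < 0 -> cross v w y2 < 0 ->
    joined K y1 y2.
  move=> b1 b2 s1 s2; apply: joined_seg => z sz Kz.
  have [_] := corner_K_ge0 (box_convex b1 b2 sz) Kz.
  case: sz => t [t01 e1 e2]; rewrite (cross_affine2 v w e1 e2) leNgt.
  by rewrite conv_lt.
have toc y1 : box v e y1 -> cross v y1 u < 0 \/ cross v w y1 < 0 -> joined K y1 c.
  by move=> b1 [s1|s1]; [apply: side1|apply: side2] => //; lra.
by move=> b1 b2 s1 s2; apply: joined_trans (toc y b1 s1) (joined_sym (toc y' b2 s2)).
Qed.

End ConvexCorner.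

Lemma collinear_coef v w x : w <> v -> cross v w x = 0 ->
  exists s : R, x.1 = v.1 + s * (w.1 - v.1) /\ x.2 = v.2 + s * (w.2 - v.2).
Proof.
rewrite /cross => ne k0; have [e1|n1] := eqVneq w.1 v.1; last first.
  have n1' : w.1 - v.1 != 0 by rewrite subr_eq0.
  exists ((x.1 - v.1) / (w.1 - v.1)); split; first by field.
  apply: (mulfI n1'); rewrite mulrDr mulrA (mulrC _ (_ / _)) divfK //; lra.
have [e2|n2] := eqVneq w.2 v.2.
  by case: ne; rewrite (surjective_pairing w) e1 e2 -surjective_pairing.
have n2' : w.2 - v.2 != 0 by rewrite subr_eq0.
exists ((x.2 - v.2) / (w.2 - v.2)); split; last by field.
rewrite e1 subrr mul0r sub0r in k0; rewrite e1 subrr mulr0 addr0.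
by move/eqP: k0; rewrite oppr_eq0 mulf_eq0 (negbTE n2') /= subr_eq0 => /eqP.
Qed.

Lemma flat_off K v u w (e g : R) x : corner K v u w e -> w <> v -> 0 < g ->
  u.1 - v.1 = - g * (w.1 - v.1) -> u.2 - v.2 = - g * (w.2 - v.2) ->
  box v e x -> K x <-> cross v w x = 0.
Proof.
move=> [e0 h nu nw] wv g0 eu1 eu2 bx; rewrite (h x bx); split.
  by case=> -[t [_ e1 e2]]; rewrite /cross e1 e2 ?eu1 ?eu2; ring.
move=> /(collinear_coef wv)[s [e1 e2]]; have [s0|s0] := leP 0 s.
  by right; apply: (@ray_box _ _ _ e s).
have gn : g != 0 by rewrite gt_eqF.
left; apply: (@ray_box _ _ _ e (- s / g)) => //.
- by rewrite divr_ge0; lra.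
- by rewrite e1 eu1; field.
- by rewrite e2 eu2; field.
Qed.

Lemma flat_joined K v u w (e g : R) y y' : corner K v u w e -> w <> v -> 0 < g ->
  u.1 - v.1 = - g * (w.1 - v.1) -> u.2 - v.2 = - g * (w.2 - v.2) ->
  box v e y -> box v e y' -> 0 < cross v w y * cross v w y' -> joined K y y'.
Proof.
move=> hK wv g0 eu1 eu2 b1 b2 s12; apply: joined_seg => z sz.
rewrite (flat_off hK wv g0 eu1 eu2 (box_convex b1 b2 sz)).
case: sz => t [t01 e1 e2]; rewrite (cross_affine2 v w e1 e2).
have [|c1|c1] := ltrgtP (cross v w y) 0; last by move: s12; rewrite c1 mul0r ltxx.
- move=> c1; rewrite nmulr_rgt0 // in s12.
  by have := conv_lt t01 c1 s12; lra.
- rewrite pmulr_rgt0 // in s12.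
  by have := conv_gt t01 c1 s12; lra.
Qed.

(** A proper or a straight angle. Excluded are arms in the same direction, which would not cut the
    box in two. *)
Definition spread v u w := cross v w u != 0 \/
  exists g : R, [/\ 0 < g, w <> v, u.1 - v.1 = - g * (w.1 - v.1) &
    u.2 - v.2 = - g * (w.2 - v.2)].

(** Off the curve the box consists of two pieces, each joined within itself and hence of constant
    parity. By [flip_near] both parities occur in the box, so the parity tells the pieces apart. *)
Lemma germ_corner l v u w (e : R) : simple l -> on_curve l v ->
  corner (on_curve l) v u w e -> spread v u w ->
  forall y y', box v e y -> box v e y' -> ~ on_curve l y -> ~ on_curve l y' ->
  par l y = par l y' -> joined (on_curve l) y y'.
Proof.
move=> sl lv hK sp.
have e0 : 0 < e by case: hK.
have [z [z' [bz bz' nz nz' pz]]] := flip_near sl lv e0.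
suff [S1 [S2 [S12 J1 J2]]] : exists S1 S2 : R * R -> Prop,
    [/\ forall y, box v e y -> ~ on_curve l y -> S1 y \/ S2 y,
       forall y y', box v e y -> box v e y' -> S1 y -> S1 y' ->
         joined (on_curve l) y y' &
       forall y y', box v e y -> box v e y' -> S2 y -> S2 y' ->
         joined (on_curve l) y y'].
  have noflip y y' : box v e y -> box v e y' -> S1 y -> S2 y' -> par l y = par l y' ->
      False.
    move=> b1 b2 s1 s2 p.
    have pp y1 : box v e y1 -> ~ on_curve l y1 -> par l y1 = par l y.
      move=> b n; have [s|s] := S12 _ b n.
        exact: par_joined (J1 _ _ b b1 s s1).
      by rewrite p; exact: par_joined (J2 _ _ b b2 s s2).
    by move: pz; rewrite !pp // eqxx.
  move=> y y' b1 b2 n1 n2 p.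
  have [s1|s1] := S12 _ b1 n1; have [s2|s2] := S12 _ b2 n2.
  - exact: J1.
  - by case: (noflip _ _ b1 b2 s1 s2 p).
  - by case: (noflip _ _ b2 b1 s2 s1 (esym p)).
  - exact: J2.
case: sp => [|[g [g0 wv eu1 eu2]]].
  rewrite neq_lt => /orP[k0|k0].
    have k0' : 0 < cross v u w by move: k0; rewrite /cross; lra.
    do 2 eexists; split.
    - exact: (corner_off (cornerC hK) k0').
    - by move=> y y' b1 b2 [? ?] [? ?]; apply: (corner_in_joined (cornerC hK) k0').
    - exact: (corner_out_joined (cornerC hK) k0').
  do 2 eexists; split.
  - exact: (corner_off hK k0).
  - by move=> y y' b1 b2 [? ?] [? ?]; apply: (corner_in_joined hK k0).
  - exact: (corner_out_joined hK k0).
exists (fun y => 0 < cross v w y), (fun y => cross v w y < 0); split.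
- move=> y b1; rewrite (flat_off hK wv g0 eu1 eu2 b1) => /eqP.
  by rewrite neq_lt => /orP[]; auto.
- by move=> y y' b1 b2 c1 c2; apply: (flat_joined hK wv g0 eu1 eu2) => //; rewrite mulr_gt0.
- by move=> y y' b1 b2 c1 c2; apply: (flat_joined hK wv g0 eu1 eu2) => //; rewrite nmulr_rgt0.
Qed.

End Germs.

(** * The complement of the curve has two components *)

Section Separation.
Variable R : realType.
Implicit Types (a b c d q x y v w u : R * R) (l : seq (R * R)).

Lemma simple_no_2cycle l v w : simple l -> (v, w) \in edges l ->
  (w, v) \in edges l -> False.
Proof.
move=> sl vw wv; have [_ sz _] := sl.
have [vl _] := edgesP vw; have [k s e] := rot_to vl.
move: sz (simple_rot k sl); rewrite -(size_rot k) e.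
rewrite -!(perm_mem (edges_rot k l)) e in vw wv.
case: s {e} vw wv => [|w' [|z s]] // vw wv _ [us _ _].
have vw' : (v, w') \in edges [:: v, w', z & s] by rewrite mem_head.
have e := edges_inj1 us vw vw'; subst w'.
have wz : (w, z) \in edges [:: v, w, z & s] by rewrite inE mem_head orbT.
have e := edges_inj1 us wv wz; subst z.
by move: us; rewrite /= !inE eqxx !orbT.
Qed.

Lemma on_seg_trans a b x y z : on_seg a b x -> on_seg a b y -> on_seg x y z ->
  on_seg a b z.
Proof.
move=> [t [/andP[t0 t1] e1 e2]] [s [/andP[s0 s1] f1 f2]] [r [r01 g1 g2]].
exists (t + r * (s - t)); split; last 2 first.
- by rewrite g1 e1 f1; ring.
- by rewrite g2 e2 f2; ring.
by move: r01 => /andP[r0 r1]; apply/andP; split; nra.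
Qed.

Lemma on_seg_split a b x y : on_seg a b x ->
  on_seg a b y <-> on_seg x a y \/ on_seg x b y.
Proof.
move=> abx; split; last first.
  by case; apply: on_seg_trans => //; [exact: on_segl|exact: on_segr].
move: abx => [t [/andP[t0 t1] e1 e2]] [s [/andP[s0 s1] f1 f2]].
have [st|st] := leP s t.
- left; have [t00|tn] := eqVneq t 0.
    have s00 : s = 0 by lra.
    by exists 0; subst t s; split; [rewrite lexx ler01|rewrite f1 e1; ring|rewrite f2 e2; ring].
  have tp : 0 < t by rewrite lt_neqAle eq_sym tn.
  exists (1 - s / t); split.
  + by rewrite subr_ge0 ler_pdivrMr // mul1r st gerBl divr_ge0.
  + by rewrite f1 e1; field.
  + by rewrite f2 e2; field.
- right; have tp : 0 < 1 - t by lra.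
  have tn : 1 - t != 0 by rewrite gt_eqF.
  exists ((s - t) / (1 - t)); split.
  + by rewrite divr_ge0 ?ler_pdivrMr //; lra.
  + by rewrite f1 e1; field.
  + by rewrite f2 e2; field.
Qed.

Lemma corner_edge l a b (t : R) : simple l -> (a, b) \in edges l -> 0 < t < 1 ->
  exists e, corner (on_curve l) (pt_on a b t) a b e.
Proof.
move=> sl ab t01; set x := pt_on a b t.
have /andP[t0 t1] := t01.
have nab := simple_neq sl ab.
have xab : on_seg a b x by apply: on_seg_pt; lra.
(* The degenerate segments at [a] and [b] keep the ends of the edge out of the box, as [corner]
   requires. *)
have [|e e0 he] := @box_off_segs R
   ((a, a) :: (b, b) :: [seq e <- edges l | e != (a, b)]) x.
  move=> c d; rewrite !inE mem_filter.
  move=> /or3P[/eqP[-> ->]|/eqP[-> ->]|/andP[/eqP ne cd]].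
  - move=> [s [_ e1 e2]]; apply: nab; move: e1 e2; rewrite /x /pt_on /= => e1 e2.
    by rewrite (surjective_pairing a) (surjective_pairing b); congr pair; nra.
  - move=> [s [_ e1 e2]]; apply: nab; move: e1 e2; rewrite /x /pt_on /= => e1 e2.
    by rewrite (surjective_pairing a) (surjective_pairing b); congr pair; nra.
  - by move=> h; apply: ne; apply: (simple_off_edge sl ab t01 cd h).
exists e; split => //.
- move=> y xy; rewrite -on_seg_split //; split=> [[c [d [cd h]]]|h]; last by exists a, b.
  have [[ec ed]|ne] := eqVneq (c, d) (a, b); first by subst c d.
  by case: (he y c d xy _ h); rewrite !inE mem_filter ne cd !orbT.
- by move=> xa; case: (he a a a xa _ (on_segl _ _)); rewrite inE eqxx.
- by move=> xb; case: (he b b b xb _ (on_segl _ _)); rewrite !inE eqxx orbT.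
Qed.

Lemma on_seg_same a x : on_seg a a x -> x = a.
Proof.
move=> [t [_ e1 e2]]; rewrite (surjective_pairing x) (surjective_pairing a) e1 e2.
by congr pair; ring.
Qed.

Lemma corner_vertex l u v w : simple l -> (u, v) \in edges l -> (v, w) \in edges l ->
  exists e, corner (on_curve l) v u w e.
Proof.
move=> sl uv vw; have [ul _ _] := sl.
have nuv := simple_neq sl uv; have nvw := simple_neq sl vw.
have [|e e0 he] := @box_off_segs R
   ((u, u) :: (w, w) :: [seq e <- edges l | (e != (u, v)) && (e != (v, w))]) v.
  move=> c d; rewrite !inE mem_filter.
  move=> /or3P[/eqP[-> ->]|/eqP[-> ->]|/andP[/andP[/eqP n1 /eqP n2] cd]].
  - by move/on_seg_same => e; apply: nuv.
  - by move/on_seg_same => e; apply: nvw.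
  - move=> h; have := simple_touch sl cd vw n2 h (on_segl _ _).
    move=> [[ed _]|[_ //]]; subst d.
    by apply: n1; rewrite (edges_inj2 ul cd uv).
exists e; split => //.
- move=> y xy; split=> [[c [d [cd h]]]|[/on_segC h|h]]; last 2 first.
  + by exists u, v.
  + by exists v, w.
  have [[ec ed]|n1] := eqVneq (c, d) (u, v); first by subst c d; left; apply: on_segC.
  have [[ec ed]|n2] := eqVneq (c, d) (v, w); first by subst c d; right.
  by case: (he y c d xy _ h); rewrite !inE mem_filter n1 n2 cd !orbT.
- by move=> xa; case: (he u u u xa _ (on_segl _ _)); rewrite inE eqxx.
- by move=> xb; case: (he w w w xb _ (on_segl _ _)); rewrite !inE eqxx orbT.
Qed.

(** With both arms in the same direction, the nearer of [u] and [w] would lie on the edge leading to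
    the other one. Injectivity then gives [u = v] or [u = w], and the latter is a 2-cycle. *)
Lemma spread_vertex l u v w : simple l -> (u, v) \in edges l -> (v, w) \in edges l ->
  spread v u w.
Proof.
move=> sl uv vw; have [ul _ hs] := sl.
have nuv := simple_neq sl uv; have nvw := simple_neq sl vw.
have [k0|] := eqVneq (cross v w u) 0; last by left.
have nwv : w <> v by move=> e; apply: nvw.
right; have [s [e1 e2]] := collinear_coef nwv k0.
have [s0|s0|s0] := ltrgtP s 0.
- by exists (- s); split; [lra|done|rewrite e1; ring|rewrite e2; ring].
- exfalso; have [s1|s1] := ltP s 1.
    have huw : on_hseg v w u by exists s; split => //; rewrite s1 ltW.
    have [e _] := hs _ _ _ _ _ vw uv huw (on_hsegl _ _).
    exact: nuv.
  have [_ wl] := edgesP vw; have [z wz] := edges_next wl.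
  have sn : s != 0 by rewrite gt_eqF.
  have hw : on_hseg u v w.
    exists (1 - s^-1); split.
    + by rewrite subr_ge0 invf_le1 // s1 gtrBl invr_gt0.
    + by rewrite e1; field.
    + by rewrite e2; field.
  have [euw _] := hs _ _ _ _ _ uv wz hw (on_hsegl _ _).
  by subst u; apply: simple_no_2cycle sl uv vw.
- exfalso; apply: nuv; rewrite (surjective_pairing u) e1 e2 s0 !mul0r !addr0.
  by rewrite -surjective_pairing.
Qed.

Lemma germ l x : simple l -> on_curve l x -> exists2 e, 0 < e &
  forall y y', box x e y -> box x e y' -> ~ on_curve l y -> ~ on_curve l y' ->
  par l y = par l y' -> joined (on_curve l) y y'.
Proof.
move=> sl cx; have [a [b [ab abx]]] := cx.
have vertex v : v \in l -> x = v -> exists2 e, 0 < e &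
  forall y y', box x e y -> box x e y' -> ~ on_curve l y -> ~ on_curve l y' ->
  par l y = par l y' -> joined (on_curve l) y y'.
  move=> vl exv; rewrite exv in cx *.
  have [w vw] := edges_next vl; have [u uv] := edges_prev vl.
  have [e ce] := corner_vertex sl uv vw.
  exists e; first by case: ce.
  exact: germ_corner sl cx ce (spread_vertex sl uv vw).
have [al bl] := edgesP ab.
case: (abx) => t [/andP[]]; rewrite le_eqVlt => /orP[/eqP <-|t0].
  move=> _ e1 e2; apply: (vertex a) => //.
  rewrite (surjective_pairing x) (surjective_pairing a) e1 e2; congr pair; ring.
rewrite le_eqVlt => /orP[/eqP ->|t1] e1 e2.
  apply: (vertex b) => //.
  rewrite (surjective_pairing x) (surjective_pairing b) e1 e2; congr pair; ring.
have ex : x = pt_on a b t by rewrite (surjective_pairing x) e1 e2.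
have t01 : 0 < t < 1 by rewrite t0.
rewrite ex in cx *; have [e ce] := corner_edge sl ab t01.
exists e; first by case: ce.
apply: (germ_corner sl cx ce); right.
have tn : 1 - t != 0 by rewrite subr_eq0 eq_sym lt_eqF.
(* An inner point of an edge is a straight corner; this is the ratio of its distances to [a] and to
   [b]. *)
exists (t / (1 - t)); split.
- by rewrite divr_gt0 // subr_gt0.
- move=> eb; apply: (simple_neq sl ab); rewrite (surjective_pairing a) (surjective_pairing b).
  move/(congr1 (fun z => (z.1, z.2))): eb; rewrite /pt_on /= => -[b1 b2].
  by congr pair; nra.
- by rewrite /pt_on /=; field.
- by rewrite /pt_on /=; field.
Qed.

Lemma pt_near a b (t e : R) : 0 < e -> exists2 r, 0 < r &
  forall s, t - r < s < t + r -> box (pt_on a b t) e (pt_on a b s).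
Proof.
move=> e0.
have [r1 /andP[r10 _] h1] := small_step (pt_on a b t) (b.1 - a.1, b.2 - a.2) e0.
have [r2 /andP[r20 _] h2] := small_step (pt_on a b t) (a.1 - b.1, a.2 - b.2) e0.
exists (Num.min r1 r2); first by rewrite lt_min r10.
have m1 : Num.min r1 r2 <= r1 by rewrite ge_min lexx.
have m2 : Num.min r1 r2 <= r2 by rewrite ge_min lexx orbT.
move=> s /andP[s1 s2]; have [ts|st] := leP t s.
- have -> : pt_on a b s = ((pt_on a b t).1 + (s - t) * (b.1 - a.1),
      (pt_on a b t).2 + (s - t) * (b.2 - a.2)).
    by rewrite /pt_on /=; congr pair; ring.
  by apply: h1; apply/andP; split; lra.
- have -> : pt_on a b s = ((pt_on a b t).1 + (t - s) * (a.1 - b.1),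
      (pt_on a b t).2 + (t - s) * (a.2 - b.2)).
    by rewrite /pt_on /=; congr pair; ring.
  by apply: h2; apply/andP; split; lra.
Qed.

Lemma pt_on0 a b : pt_on a b 0 = a.
Proof. by rewrite /pt_on !mul0r !addr0 -surjective_pairing. Qed.

Lemma pt_on1 a b : pt_on a b 1 = b.
Proof. by rewrite (surjective_pairing b) /pt_on /=; congr pair; ring. Qed.

Lemma pedges_ind (T : eqType) (P : T -> Prop) (x : T) (s : seq T) :
  (forall y z : T, (y, z) \in pedges x s -> P y -> P z) -> P x ->
  forall y : T, y \in x :: s -> P y.
Proof.
elim: s x => [|z s IH] x h Px y; first by rewrite inE => /eqP ->.
rewrite inE => /orP[/eqP -> //|]; apply: IH.
  by move=> a b ab; apply: h; rewrite inE ab orbT.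
by apply: (h x z) => //; rewrite /= mem_head.
Qed.

(** The property of being joined to [y0] is propagated along each edge by [unit_interval_ind] and
    from vertex to vertex by [pedges_ind]. *)
Lemma curve_germs_joined l (c : bool) : simple l -> exists y0,
  [/\ ~ on_curve l y0, par l y0 = c &
    forall x, on_curve l x -> exists2 e, 0 < e & forall y, box x e y ->
      ~ on_curve l y -> par l y = c -> joined (on_curve l) y y0].
Proof.
move=> sl.
have pick x (e : R) : on_curve l x -> 0 < e ->
    exists y, [/\ box x e y, ~ on_curve l y & par l y = c].
  move=> cx e0; have [y [y' [b1 b2 n1 n2 p]]] := flip_near sl cx e0.
  have [py|py] := eqVneq (par l y) c; first by exists y.
  by exists y'; split => //; move: p py; case: (par l y); case: (par l y'); case: (c).
have vc v : v \in l -> on_curve l v.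
  by move=> vl; have [w vw] := edges_next vl; exists v, w; split => //; exact: on_segl.
have [a0 a0l] : exists a0, a0 \in l.
  by case: sl => _; case: (l) => // a s _ _; exists a; rewrite mem_head.
have [e0 e00 h0] := germ sl (vc _ a0l).
have [y0 [by0 ny0 py0]] := pick _ _ (vc _ a0l) e00.
exists y0; split => //.
pose Q x := exists2 e, 0 < e & forall y, box x e y ->
      ~ on_curve l y -> par l y = c -> joined (on_curve l) y y0.
have Qa0 : Q a0 by exists e0 => // y b1 n1 p1; apply: h0 => //; rewrite p1.
have Qedge a b : (a, b) \in edges l -> Q a -> forall t, 0 <= t <= 1 -> Q (pt_on a b t).
  move=> ab Qa; apply: unit_interval_ind; last by rewrite pt_on0.
  move=> t t01; have cx : on_curve l (pt_on a b t).
    by exists a, b; split => //; apply: on_seg_pt.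
  have [e ep he] := germ sl cx.
  have ep2 : 0 < e / 2 by rewrite divr_gt0.
  have [r r0 hr] := pt_near a b t ep2.
  exists r => // s s' s01 s01' ss ss' [e1 e10 h1].
  have cs : on_curve l (pt_on a b s).
    by exists a, b; split => //; apply: on_seg_pt.
  have m0 : 0 < Num.min e1 (e / 2) by rewrite lt_min e10.
  (* [y1] lies both in the box already settled at [s] and in the germ box at [t], so it links points
     near [s'] to [y0]. *)
  have [y1 [b1 n1 p1]] := pick _ _ cs m0.
  have j1 : joined (on_curve l) y1 y0.
    by apply: h1 => //; apply: box_sub b1; rewrite ge_min lexx.
  exists (e / 2) => // y b2 n2 p2.
  apply: joined_trans j1; apply: he => //; last by rewrite p1.
  - exact: box_half (hr _ ss') b2.
  - apply: box_half (hr _ ss) (box_sub _ b1); by rewrite ge_min lexx orbT.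
have Qv v : v \in l -> Q v.
  have [k s e] := rot_to a0l.
  rewrite -(mem_rot k) e => vs; apply: (@pedges_ind _ Q a0 (rcons s a0)) => //; last first.
    by rewrite -rcons_cons mem_rcons inE vs orbT.
  move=> a b ab Qa; rewrite -(pt_on1 a b); apply: Qedge Qa _ _; last by rewrite ler01 lexx.
  by rewrite -(perm_mem (edges_rot k l)) e.
move=> x [a [b [ab [t [t01 e1 e2]]]]].
have -> : x = pt_on a b t by rewrite (surjective_pairing x) e1 e2.
by apply: Qedge => //; apply: Qv; case: (edgesP ab).
Qed.

(** Walk straight from [q] to a vertex [a]. If the points joined to [q] stayed away from the curve,
    being joined to [q] would persist up to [a], which is on the curve. *)
Lemma reach_curve l q : (0 < size l)%N -> ~ on_curve l q -> exists2 x, on_curve l x &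
  forall e, 0 < e -> exists y, box x e y /\ joined (on_curve l) q y.
Proof.
move=> sz nq; apply: contrapT => nD.
have [a [b [ab aab]]] : exists a b, (a, b) \in edges l /\ on_seg a b a.
  case: l sz {nq nD} => // a s _; have [b ab] := edges_next (mem_head a s).
  by exists a, b; split => //; exact: on_segl.
suff : joined (on_curve l) q (pt_on q a 1).
  by rewrite pt_on1 => /joined_off /(_ nq); apply; exists a, b.
apply: (@unit_interval_ind R (fun t => joined (on_curve l) q (pt_on q a t))).
- move=> t t01; have [ct|nt] := pselect (on_curve l (pt_on q a t)).
    have [e ep he] : exists2 e, 0 < e & forall y, box (pt_on q a t) e y ->
        ~ joined (on_curve l) q y.
      apply: contrapT => h; apply: nD; exists (pt_on q a t) => // e ep.
      apply: contrapT => h'; apply: h; exists e => // y bY jy; apply: h'.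
      by exists y.
    have [r r0 hr] := pt_near q a t ep; exists r => // s s' _ _ ss _ js.
    by case: (he _ (hr _ ss) js).
  have [e ep he] := box_off_curve nt.
  have [r r0 hr] := pt_near q a t ep; exists r => // s s' _ _ ss ss' js.
  apply: joined_trans js (joined_seg _) => w sw.
  by apply: he; apply: box_convex sw; apply: hr.
- by rewrite pt_on0; apply: joined_refl.
- by rewrite ler01 lexx.
Qed.

Theorem jordan l q q' : simple l -> ~ on_curve l q -> ~ on_curve l q' ->
  par l q = par l q' -> joined (on_curve l) q q'.
Proof.
move=> sl nq nq' p; have [y0 [_ _ h]] := curve_germs_joined (par l q) sl.
have sz : (0 < size l)%N by case: sl => _; case: (size l).
suff J z : ~ on_curve l z -> par l z = par l q -> joined (on_curve l) z y0.
  by apply: joined_trans (J q nq erefl) (joined_sym (J q' nq' (esym p))).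
move=> nz pz; have [x cx hx] := reach_curve sz nz.
have [e ep he] := h x cx; have [y [bY jy]] := hx e ep.
apply: (joined_trans jy); apply: (he _ bY (joined_off jy nz)).
by rewrite -(par_joined jy).
Qed.

End Separation.

(** * Cutting along a diagonal *)

Section Split.
Variable R : realType.
Implicit Types (a b c d q x y z v w u : R * R) (l s : seq (R * R)).

(* On the curve itself the value of [par] is meaningless. *)
Definition region l q : Prop := on_curve l q \/ par l q.

Definition inner_diagonal l x z := forall t : R, 0 < t < 1 ->
  ~ on_curve l (pt_on x z t) /\ par l (pt_on x z t).

Lemma below_out l q : (forall v, v \in l -> q.2 < v.2) ->
  ~ on_curve l q /\ par l q = false.
Proof.
move=> h; split.
  move=> [a [b [ab [t [t01 _ e2]]]]]; have [/h al /h bl] := edgesP ab.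
  by have := conv_gt t01 al bl; rewrite -e2 ltxx.
rewrite /par big_seq big1 // => -[a b] ab /=; have [/h al /h bl] := edgesP ab.
by rewrite /ray !leNgt al bl.
Qed.

Lemma exists_below l : exists q, forall v, v \in l -> q.2 < v.2.
Proof.
elim: l => [|v l [q hq]]; first by exists 0.
exists (0, Num.min q.2 (v.2 - 1)) => u /=; rewrite inE gt_min => /orP[/eqP ->|/hq ->//].
by apply/orP; right; lra.
Qed.

Lemma on_seg_open a b y : on_seg a b y -> [\/ y = a, y = b |
  exists2 t : R, 0 < t < 1 & y = pt_on a b t].
Proof.
move=> [t [/andP[t0 t1] e1 e2]].
have -> : y = pt_on a b t by rewrite (surjective_pairing y) e1 e2.
have [->|tn0] := eqVneq t 0; first by rewrite pt_on0; constructor 1.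
have [->|tn1] := eqVneq t 1; first by rewrite pt_on1; constructor 2.
by constructor 3; exists t => //; rewrite !lt_neqAle t0 t1 tn1 eq_sym tn0.
Qed.

Lemma pt_onC a b (t : R) : pt_on a b t = pt_on b a (1 - t).
Proof. by rewrite /pt_on; congr pair; ring. Qed.

Lemma diagonalC l x z : inner_diagonal l x z -> inner_diagonal l z x.
Proof. by move=> h t /andP[t0 t1]; rewrite pt_onC; apply: h; apply/andP; split; lra. Qed.

Lemma diagonal_rot k l x z : inner_diagonal l x z -> inner_diagonal (rot k l) x z.
Proof. by move=> h t /h; rewrite par_rot on_curve_rot. Qed.

(** A path along which the parity of [l'] changes must meet [l']; as the path avoids [l], the
    meeting point keeps the parity of [x] with respect to [l]. *)
Lemma joined_cross l l' x y : joined (on_curve l) x y -> ~ on_curve l x ->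
  par l' x != par l' y ->
  exists k, [/\ on_curve l' k, ~ on_curve l k & par l k = par l x].
Proof.
move=> j nx; elim: j => [|y' z j IH h p]; first by rewrite eqxx.
have [p'|/IH//] := eqVneq (par l' x) (par l' y').
apply: contrapT => nk; move/eqP: p; apply; rewrite p'.
apply: par_seg => -[k [ck sk]]; apply: nk; exists k; split => //; first exact: h.
rewrite (par_joined j); apply/esym/par_seg => -[w [cw sw]]; apply: (h w) => //.
exact: on_seg_trans (on_segl _ _) sk sw.
Qed.

Lemma on_seg_ends a b k : a <> b -> on_seg a b k -> on_seg k b a -> k = a.
Proof.
move=> ab [t [/andP[t0 t1] e1 e2]] [s [/andP[s0 s1] f1 f2]].
have st : (1 - (1 - s) * (1 - t)) = 0.
  apply/eqP/negPn/negP => n; apply: ab.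
  rewrite (surjective_pairing a) (surjective_pairing b); congr pair; apply: (mulfI n).
    by rewrite e1 in f1; lra.
  by rewrite e2 in f2; lra.
have st' : 0 <= s * (1 - t) by rewrite mulr_ge0 ?subr_ge0.
have t00 : t = 0 by clear ab e1 e2 f1 f2; lra.
by rewrite (surjective_pairing k) (surjective_pairing a) e1 e2 t00; congr pair; ring.
Qed.

Lemma on_hseg_end a b : on_hseg a b b -> a = b.
Proof.
move=> [t [/andP[t0 t1] e1 e2]]; have n : 1 - t != 0 by rewrite gt_eqF; lra.
by rewrite (surjective_pairing a) (surjective_pairing b); congr pair;
  apply: (mulfI n); lra.
Qed.

Lemma mem_on_curve l v : v \in l -> on_curve l v.
Proof. by move/edges_next => [w vw]; exists v, w; split => //; exact: on_segl. Qed.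

Section SplitAt.
Variables (x z : R * R) (s1 s2 : seq (R * R)).
Let l := x :: s1 ++ z :: s2.
Let l1 := x :: rcons s1 z.
Let l2 := z :: rcons s2 x.
Hypotheses (sl : simple l) (n1 : s1 != [::]) (n2 : s2 != [::]).
Hypothesis dg : inner_diagonal l x z.
Let P1 := pedges x (rcons s1 z).
Let P2 := pedges z (rcons s2 x).

Lemma split_edges : edges l = P1 ++ P2.
Proof. exact: edges_cat. Qed.

Lemma split_edges1 : edges l1 = rcons P1 (z, x).
Proof. by rewrite /l1 /edges -cats1 pedges_cat last_rcons cats1. Qed.

Lemma split_edges2 : edges l2 = rcons P2 (x, z).
Proof. by rewrite /l2 /edges -cats1 pedges_cat last_rcons cats1. Qed.

(** The diagonal is an edge of both pieces, and its two contributions cancel. *)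
Lemma split_par q : par l q = par l1 q (+) par l2 q.
Proof.
rewrite /par split_edges split_edges1 split_edges2 -!cats1 !big_cat !big_seq1 /=.
by rewrite (rayC q z x); case: (ray q x z); rewrite ?addbF // !addbT addNb addbN negbK.
Qed.

Lemma split_curve1 q : on_curve l1 q -> on_curve l q \/ on_seg z x q.
Proof.
move=> [a [b [ab h]]]; move: ab; rewrite split_edges1 mem_rcons inE.
move=> /orP[/eqP[<- <-]|ab]; first by right.
by left; exists a, b; rewrite split_edges mem_cat ab.
Qed.

Lemma split_curve q : on_curve l q -> on_curve l1 q \/ on_curve l2 q.
Proof.
move=> [a [b [ab h]]]; move: ab; rewrite split_edges mem_cat.
by move=> /orP[] ab; [left|right]; exists a, b;
  rewrite ?split_edges1 ?split_edges2 mem_rcons inE ab orbT.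
Qed.

Lemma split_curve2 q : on_curve l2 q -> on_curve l q \/ on_curve l1 q.
Proof.
move=> [a [b [ab h]]]; move: ab; rewrite split_edges2 mem_rcons inE.
move=> /orP[/eqP[ea eb]|ab]; last by left; exists a, b; rewrite split_edges mem_cat ab orbT.
right; exists z, x; rewrite split_edges1 mem_rcons mem_head; split => //.
by subst a b; apply: on_segC.
Qed.

Lemma split_uniq : [/\ uniq (x :: s1), uniq (z :: s2), x != z &
  forall v, v \in x :: s1 -> v \notin z :: s2].
Proof.
have [] := sl; rewrite /l -cat_cons cat_uniq => /and3P[u1 /hasPn d u2] _ _; split => //.
  by apply/eqP => e; have := d z (mem_head _ _); rewrite /= e mem_head.
by move=> v v1; apply/negP => /d /=; rewrite v1.
Qed.

Lemma P1P a b : (a, b) \in P1 -> a \in x :: s1 /\ b \in rcons s1 z.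
Proof.
move=> ab; split.
- by rewrite -(unzip1_pedges x s1 z); apply/mapP; exists (a, b).
- by rewrite -(unzip2_pedges x (rcons s1 z)); apply/mapP; exists (a, b).
Qed.

Lemma P2P a b : (a, b) \in P2 -> a \in z :: s2 /\ b \in rcons s2 x.
Proof.
move=> ab; split.
- by rewrite -(unzip1_pedges z s2 x); apply/mapP; exists (a, b).
- by rewrite -(unzip2_pedges z (rcons s2 x)); apply/mapP; exists (a, b).
Qed.

Lemma split_simple : simple l1.
Proof.
have [ul sz hs] := sl; have [u1 u2 xz dis] := split_uniq.
have zl : z \in l by rewrite /l inE mem_cat mem_head !orbT.
have [z' zz'] := edges_next zl.
have key c d y : (c, d) \in P1 -> on_hseg c d y -> on_hseg z x y -> False.
  move=> cd h h'; have := on_seg_open (on_hsegW h').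
  have cdl : (c, d) \in edges l by rewrite split_edges mem_cat cd.
  have [cx dx] := P1P cd.
  have yl : on_curve l y by exists c, d; split => //; apply: on_hsegW.
  case=> [e|e|[t t01 e]]; subst y.
  - have [e _] := hs _ _ _ _ _ cdl zz' h (on_hsegl _ _); subst c.
    by have := dis _ cx; rewrite mem_head.
  - by move/eqP: xz; apply; rewrite (on_hseg_end h').
  - by have [] := diagonalC dg t01.
split.
- rewrite /l1 -rcons_cons rcons_uniq u1 andbT; apply/negP => /dis.
  by rewrite mem_head.
- by rewrite /l1 /= size_rcons; case: (s1) n1.
- move=> a b c d y; rewrite split_edges1 !mem_rcons !inE.
  move=> /orP[/eqP[-> ->]|ab] /orP[/eqP[-> ->]|cd] // h h'.
  + by case: (key c d y).
  + by case: (key a b y).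
  + by apply: hs h h'; rewrite split_edges mem_cat ?ab ?cd.
Qed.

Lemma split_edge_touch a b y : (a, b) \in P2 -> on_seg a b y -> on_curve l1 y ->
  (y = z /\ a = z) \/ (y = x /\ b = x).
Proof.
move=> ab h; have [ul sz hs] := sl; have [u1 u2 xz dis] := split_uniq.
have [a2 b2] := P2P ab.
have abl : (a, b) \in edges l by rewrite split_edges mem_cat ab orbT.
have old c d : (c, d) \in P1 -> on_seg c d y ->
    (y = z /\ a = z) \/ (y = x /\ b = x).
  move=> cd h'; have [c1 d1] := P1P cd.
  have cdl : (c, d) \in edges l by rewrite split_edges mem_cat cd.
  have ne : (a, b) <> (c, d).
    by move=> [e _]; subst a; move: a2; apply/negP/dis.
  case: (simple_touch sl abl cdl ne h h') => -[e e'].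
  - right; subst y; move: b2; rewrite e' mem_rcons inE => /orP[/eqP ->//|cs].
    by have := dis _ c1; rewrite inE cs orbT.
  - left; subst y; move: d1; rewrite -e' mem_rcons inE => /orP[/eqP ->//|as1].
    by have := dis a; rewrite inE as1 orbT a2 => /(_ isT).
move=> [c [d [cd h']]]; move: cd; rewrite split_edges1 mem_rcons inE.
move=> /orP[/eqP[ec ed]|/old]; last exact.
subst c d; case: (on_seg_open h') => [e|e|[t t01 e]]; last 1 first.
- have [nl _] := diagonalC dg t01; case: nl; rewrite -e.
  by exists a, b.
- have [c zc] : exists c, (z, c) \in edges l.
    by apply: edges_next; rewrite /l inE mem_cat mem_head !orbT.
  have [[ea _]|/eqP ne] := eqVneq (a, b) (z, c); first by left.
  case: (simple_touch sl abl zc ne h); rewrite e; first exact: on_segl.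
    move=> [eb _]; move: b2; rewrite -eb mem_rcons inE eq_sym (negbTE xz) /= => zs2.
    by move: u2; rewrite /= zs2.
  by move=> [ea _]; left.
- have [c xc] : exists c, (x, c) \in edges l by apply: edges_next; rewrite mem_head.
  have ax : a <> x.
    by move=> ea; subst a; have := dis x; rewrite mem_head a2 => /(_ isT).
  have ne : (a, b) <> (x, c) by move=> [].
  case: (simple_touch sl abl xc ne h); rewrite e; first exact: on_segl.
    by move=> [eb _]; right.
  by move=> [ea _]; case: ax.
Qed.

(** Slide [k] along its edge to [a] if [b = x], and to [b] otherwise; the target is in [s2] because
    [s2] is nonempty. By [split_edge_touch] the slide could meet the first piece only at the
    opposite end of the edge, and then [k] would be that end. *)
Lemma split_edge_joined a b k : (a, b) \in P2 -> on_seg a b k -> ~ on_curve l1 k ->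
  exists2 v, v \in s2 & joined (on_curve l1) k v.
Proof.
move=> ab h nk; have [ul sz hs] := sl; have [u1 u2 xz dis] := split_uniq.
have [a2 b2] := P2P ab.
have abl : (a, b) \in edges l by rewrite split_edges mem_cat ab orbT.
have nab := simple_neq sl abl.
have zl1 : on_curve l1 z.
  by exists z, x; rewrite split_edges1 mem_rcons mem_head; split => //; exact: on_segl.
have xl1 : on_curve l1 x.
  by exists z, x; rewrite split_edges1 mem_rcons mem_head; split => //; exact: on_segr.
have [ebx|nbx] := eqVneq b x.
  have naz : a <> z.
    move=> ea; have [c cs zc] : exists2 c, c \in s2 & (z, c) \in P2.
      by rewrite /P2; case: (s2) n2 => // c s _; exists c; rewrite mem_head.
    have zcl : (z, c) \in edges l by rewrite split_edges mem_cat zc orbT.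
    subst a b; have e := edges_inj1 ul abl zcl; subst c.
    by have := dis x; rewrite mem_head inE cs orbT => /(_ isT).
  have as2 : a \in s2 by move: a2; rewrite inE => /orP[/eqP|].
  exists a => //; apply: joined_seg => y sy ny.
  have aby : on_seg a b y by apply: on_seg_trans h (on_segl _ _) sy.
  case: (split_edge_touch ab aby ny) => -[ey e]; first by case: naz.
  have yb : y = b by rewrite ey e.
  have kb : k = b.
    apply: (@on_seg_ends b a); [by move=> e'; apply: nab|exact: on_segC|].
    by rewrite -yb.
  by apply: nk; rewrite kb e.
have bs2 : b \in s2 by move: b2; rewrite mem_rcons inE (negbTE nbx).
exists b => //; apply: joined_seg => y sy ny.
have aby : on_seg a b y by apply: on_seg_trans h (on_segr _ _) sy.
case: (split_edge_touch ab aby ny) => -[ey e]; last by rewrite e eqxx in nbx.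
have ya : y = a by rewrite ey e.
have ka : k = a by apply: (on_seg_ends nab h); rewrite -ya.
by apply: nk; rewrite ka e.
Qed.

Lemma split_chain_joined k k' : on_curve l2 k -> on_curve l2 k' ->
  ~ on_curve l1 k -> ~ on_curve l1 k' -> joined (on_curve l1) k k'.
Proof.
have [u1 u2 xz dis] := split_uniq.
have tov y : on_curve l2 y -> ~ on_curve l1 y ->
    exists2 v, v \in s2 & joined (on_curve l1) y v.
  move=> [a [b [ab h]]] ny; move: ab; rewrite split_edges2 mem_rcons inE.
  move=> /orP[/eqP[ea eb]|ab]; last exact: split_edge_joined ab h ny.
  case: ny; exists z, x; rewrite split_edges1 mem_rcons mem_head; split => //.
  by subst a b; apply: on_segC.
have [c hc] : exists c, forall v, v \in s2 -> joined (on_curve l1) c v.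
  move: n2 u2 dis split_edge_touch; rewrite /P2; case: (s2) => // c s _ u2' dis' tch.
  exists c; apply: pedges_ind; last exact: joined_refl.
  move=> a b ab /joined_trans; apply; apply: joined_seg => y sy ny.
  have ab' : (a, b) \in pedges z (rcons (c :: s) x).
    by rewrite /= -cats1 pedges_cat inE mem_cat ab orbT.
  have ac : a \in c :: s.
    by rewrite -(unzip1_pedges c s x) -cats1 pedges_cat; apply/mapP; exists (a, b) => //;
      rewrite mem_cat ab.
  have bs : b \in s by rewrite -(unzip2_pedges c s); apply/mapP; exists (a, b).
  case: (tch a b y ab' sy ny) => -[_ e]; subst.
    by move: u2'; rewrite /= ac.
  by have := dis' x; rewrite mem_head !inE bs !orbT => /(_ isT).
move=> ck ck' nk nk'; have [v vs j] := tov k ck nk; have [v' vs' j'] := tov k' ck' nk'.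
exact: joined_trans j (joined_trans (joined_sym (hc v vs)) (joined_trans (hc v' vs') (joined_sym j'))).
Qed.

(* If both pieces had parity 1 at [q], then joining [q] to a point next to the
   diagonal, and a far point to one on its other side, the chain of the second
   piece would contain points of both parities with respect to the first; but
   that chain is connected off the first piece. *)
Lemma split_region1 q : region l1 q -> region l q.
Proof.
have [cl|ncl] := pselect (on_curve l q); first by left.
have sl1 := split_simple.
have zxl1 : (z, x) \in edges l1 by rewrite split_edges1 mem_rcons mem_head.
have half : 0 < (1 / 2%:R : R) < 1 by apply/andP; split; lra.
have [cl1 _|ncl1] := pselect (on_curve l1 q).
  case: (split_curve1 cl1) => // h; case: (on_seg_open h) => [e|e|[t t01 e]].
  - by left; rewrite e; apply: mem_on_curve; rewrite /l inE mem_cat mem_head !orbT.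
  - by left; rewrite e; apply: mem_on_curve; rewrite mem_head.
  - by right; rewrite e; have [] := diagonalC dg t01.
have ncl2 : ~ on_curve l2 q by move=> /split_curve2[].
case=> // p1; right; rewrite split_par p1; case p2 : (par l2 q) => //; exfalso.
have [nm pm] := diagonalC dg half; set m := pt_on z x _ in nm pm.
have [e e0 he] := box_off_curve nm.
have pball y : box m e y -> par l y.
  move=> b; suff <- : par l m = par l y by []; apply: par_seg => -[w [cw sw]]; apply: (he w) => //.
  by apply: box_convex sw => //; exact: box_center.
have [y [y' [yb yb' ny ny' py]]] : exists y y', [/\ box m e y, box m e y',
    ~ on_curve l1 y, ~ on_curve l1 y' & par l1 y && ~~ par l1 y'].
  have [y [y' [b1 b2 o1 o2 p]]] := flip_edge sl1 zxl1 half e0.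
  case py : (par l1 y); [exists y, y'|exists y', y]; split => //;
    by move: p; rewrite py; case: (par l1 y').
move/andP: py => /= [py1 py1'].
(* The parity of [l] is 1 on both sides of the diagonal near [m], so exactly one piece has parity 1
   at [y], and the other one at [y']. *)
have py2 : par l2 y = false by have := pball y yb; rewrite split_par py1; case: (par l2 y).
have py2' : par l2 y' by have := pball y' yb'; rewrite split_par (negbTE py1').
have [f hf] := exists_below (l1 ++ l2).
have [nf1 pf1] : ~ on_curve l1 f /\ par l1 f = false.
  by apply: below_out => v vl; apply: hf; rewrite mem_cat vl.
have [nf2 pf2] : ~ on_curve l2 f /\ par l2 f = false.
  by apply: below_out => v vl; apply: hf; rewrite mem_cat vl orbT.
have j1 : joined (on_curve l1) q y by apply: jordan; rewrite ?p1 ?py1.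
have j2 : joined (on_curve l1) f y' by apply: jordan; rewrite ?pf1 ?(negbTE py1').
have [|k [k2 nk pk]] := joined_cross (l' := l2) j1 ncl1; first by rewrite p2 py2.
have [|k' [k2' nk' pk']] := joined_cross (l' := l2) j2 nf1; first by rewrite pf2 py2'.
have := par_joined (split_chain_joined k2 k2' nk nk').
by rewrite pk pk' p1 pf1.
Qed.

End SplitAt.
End Split.

(** * Existence of a diagonal *)

Section Ear.
Variable R : realType.
Implicit Types (a b c d p q x y z v w u : R * R) (l s : seq (R * R)).

(** Unordered, because the orientation of the curve is not known and the neighbours of the lowest
    vertex get exchanged to make the cross product positive. *)
Definition adj l a b := (a, b) \in edges l \/ (b, a) \in edges l.

Lemma adjC l a b : adj l a b -> adj l b a.
Proof. by case; [right|left]. Qed.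

Lemma adj_mem l a b : adj l a b -> a \in l /\ b \in l.
Proof. by case=> /edgesP[]. Qed.

Lemma adj_neq l a b : simple l -> adj l a b -> a <> b.
Proof. by move=> sl [] /(simple_neq sl) // ne e; apply: ne. Qed.

Lemma adj_touch l a b c d x : simple l -> adj l a b -> adj l c d ->
  on_seg a b x -> on_seg c d x ->
  [\/ a = c /\ b = d, a = d /\ b = c | (x = a \/ x = b) /\ (x = c \/ x = d)].
Proof.
move=> sl; wlog ab : a b / (a, b) \in edges l.
  move=> W [] ab; first by apply: W => //; left.
  move=> cd /on_segC xab xcd.
  by case: (W b a ab (or_introl ab) cd xab xcd) => [[-> ->]|[-> ->]|[h1 h2]];
    [constructor 2|constructor 1|constructor 3; split => //; case: h1; auto].
wlog cd : c d / (c, d) \in edges l.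
  move=> W _ [] cd; first by apply: W => //; left.
  move=> xab /on_segC xcd.
  by case: (W d c cd (or_introl ab) (or_introl cd) xab xcd) => [[-> ->]|[-> ->]|[h1 h2]];
    [constructor 2|constructor 1|constructor 3; split => //; case: h2; auto].
move=> _ _ xab xcd; have [[-> ->]|/eqP ne] := eqVneq (a, b) (c, d).
  by constructor 1.
by case: (simple_touch sl ab cd ne xab xcd) => -[-> <-]; constructor 3; auto.
Qed.

Lemma vertex_on_edge l a b x : simple l -> adj l a b -> x \in l -> on_seg a b x ->
  x = a \/ x = b.
Proof.
move=> sl ab xl h; have [y xy] := edges_next xl.
case: (adj_touch sl ab (or_introl xy) h (on_segl _ _)) => [[-> _]|[_ ->]|[]//]; auto.
Qed.

Lemma on_curve_adj l x : on_curve l x <-> exists a b, adj l a b /\ on_seg a b x.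
Proof.
split=> [[a [b [ab h]]]|[a [b [[] ab h]]]]; first by exists a, b; split => //; left.
  by exists a, b.
by exists b, a; split => //; apply: on_segC.
Qed.

Lemma seq_argmin (T : eqType) (f : T -> R) (s : seq T) : s != [::] ->
  exists2 z : T, z \in s & forall y : T, y \in s -> f z <= f y.
Proof.
elim: s => // a s IH _; have [->|/IH[z zs hz]] := eqVneq s [::].
  by exists a; rewrite ?mem_head // => y; rewrite inE => /eqP ->.
have [fa|fz] := leP (f a) (f z).
  exists a; rewrite ?mem_head // => y; rewrite inE => /orP[/eqP -> //|/hz].
  exact: le_trans.
exists z; rewrite ?inE ?zs ?orbT // => y; rewrite inE => /orP[/eqP ->|/hz //].
exact: ltW.
Qed.

(** Choosing the leftmost among the lowest vertices excludes a straight horizontal angle there. *)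
Lemma exists_lowest l : l != [::] -> exists2 v, v \in l &
  forall x, x \in l -> v.2 < x.2 \/ (v.2 = x.2 /\ v.1 <= x.1).
Proof.
move=> l0; have [m ml hm] := seq_argmin (fun x => x.2) l0.
have [|v] := @seq_argmin _ (fun x : R * R => x.1) [seq x <- l | x.2 == m.2].
  by rewrite -has_filter; apply/hasP; exists m.
rewrite mem_filter => /andP[/eqP vm vl] hv; exists v => // x xl; rewrite vm.
have := hm x xl; rewrite le_eqVlt => /orP[/eqP e|]; last by left.
by right; split => //; apply: hv; rewrite mem_filter e eqxx.
Qed.

Lemma above_out l q : (forall v, v \in l -> v.2 < q.2) ->
  ~ on_curve l q /\ par l q = false.
Proof.
move=> h; split.
  move=> [a [b [ab [t [t01 _ e2]]]]]; have [/h al /h bl] := edgesP ab.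
  by have := conv_lt t01 al bl; rewrite -e2 ltxx.
rewrite /par big_seq big1 // => -[a b] ab /=; have [/h al /h bl] := edgesP ab.
by rewrite /ray (ltW al) (ltW bl).
Qed.

(** The level line through [q] misses the curve. Unless it is horizontal, it leads to a point below
    all vertices; if it is horizontal, [q] itself is below or above all of them. *)
Lemma halfplane_out l q (c1 c2 : R) : l != [::] ->
  (forall v, v \in l -> c1 * v.1 + c2 * v.2 < c1 * q.1 + c2 * q.2) ->
  ~ on_curve l q /\ par l q = false.
Proof.
move=> l0 h.
have hc x : c1 * x.1 + c2 * x.2 = c1 * q.1 + c2 * q.2 -> ~ on_curve l x.
  move=> e [a [b [ab [t [t01 e1 e2]]]]]; have [/h al /h bl] := edgesP ab.
  by have := conv_lt t01 al bl; rewrite -e e1 e2 => H; lra.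
split; first exact: hc.
have [c10|c1n] := eqVneq c1 0; last first.
  have [f hf] := exists_below l.
  pose s := (q.2 - f.2) / c1.
  pose y : R * R := (q.1 + c2 * s, f.2).
  have ey : c1 * s = q.2 - f.2 by rewrite /s; field.
  have [_ <-] : ~ on_curve l y /\ par l y = false by apply: below_out.
  apply: par_seg => -[x [cx [t [_ e1 e2]]]]; apply: (hc x) => //.
  have fE : f.2 = q.2 - c1 * s by lra.
  by rewrite e1 e2 /y /= fE; ring.
have [c20|c20|c20] := ltrgtP c2 0.
- suff : ~ on_curve l q /\ par l q = false by case.
  by apply: below_out => v /h; rewrite c10 !mul0r !add0r ltr_nM2l.
- suff : ~ on_curve l q /\ par l q = false by case.
  by apply: above_out => v /h; rewrite c10 !mul0r !add0r ltr_pM2l.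
- case: l l0 h {hc} => // a l _ /(_ a (mem_head _ _)).
  by rewrite c10 c20 !mul0r ltxx.
Qed.

Lemma pt_on_pt a b (s t : R) : pt_on a (pt_on a b s) t = pt_on a b (t * s).
Proof. by rewrite /pt_on /=; congr pair; ring. Qed.

(** * The cone at the lowest vertex *)

Section LowestCorner.
Variables (l : seq (R * R)) (v u w : R * R) (e : R).
Hypotheses (sl : simple l) (vu : adj l v u) (vw : adj l v w).
Hypothesis nbr : forall d, adj l v d -> d = u \/ d = w.
Hypothesis hK : corner (on_curve l) v u w e.
Hypothesis low : forall x, x \in l -> v.2 <= x.2.
Hypothesis k0 : 0 < cross v w u.
(** [A] and [B] are the coordinates of [cross_coord] scaled by [k]: the cone at [v] is where both
    are nonnegative, and the level [A + B] grows from 0 at [v] to [k] on the line through [u] and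
    [w]. *)
Let A x := cross v x u.
Let B x := cross v w x.
Let k := cross v w u.

Lemma cross_uu : A u = 0. Proof. by rewrite /A /cross; ring. Qed.
Lemma cross_vu : A v = 0. Proof. by rewrite /A /cross; ring. Qed.
Lemma cross_ww : B w = 0. Proof. by rewrite /B /cross; ring. Qed.
Lemma cross_vw : B v = 0. Proof. by rewrite /B /cross; ring. Qed.
Lemma A_w : A w = k. Proof. by []. Qed.
Lemma B_u : B u = k. Proof. by []. Qed.

Lemma A_affine y y' z (t : R) : z.1 = y.1 + t * (y'.1 - y.1) ->
  z.2 = y.2 + t * (y'.2 - y.2) -> A z = A y + t * (A y' - A y).
Proof. exact: cross_affine1. Qed.

Lemma B_affine y y' z (t : R) : z.1 = y.1 + t * (y'.1 - y.1) ->
  z.2 = y.2 + t * (y'.2 - y.2) -> B z = B y + t * (B y' - B y).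
Proof. exact: cross_affine2. Qed.

Lemma A_pt a b (t : R) : A (pt_on a b t) = A a + t * (A b - A a).
Proof. exact: A_affine. Qed.

Lemma B_pt a b (t : R) : B (pt_on a b t) = B a + t * (B b - B a).
Proof. exact: B_affine. Qed.

Lemma on_vu y : A y = 0 -> 0 <= B y <= k -> on_seg v u y.
Proof.
move=> a0 /andP[b0 b1]; have kn : cross v w u != 0 by rewrite gt_eqF.
have [e1 e2] := cross_coord y kn.
exists (B y / k); split.
- by rewrite divr_ge0 ?(ltW k0) //= ler_pdivrMr // mul1r.
- by rewrite {1}e1 -/(A y) a0 !mul0r addr0.
- by rewrite {1}e2 -/(A y) a0 !mul0r addr0.
Qed.

Lemma on_vw y : B y = 0 -> 0 <= A y <= k -> on_seg v w y.
Proof.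
move=> a0 /andP[b0 b1]; have kn : cross v w u != 0 by rewrite gt_eqF.
have [e1 e2] := cross_coord y kn.
exists (A y / k); split.
- by rewrite divr_ge0 ?(ltW k0) //= ler_pdivrMr // mul1r.
- by rewrite {1}e1 -/(B y) a0 !mul0r addr0.
- by rewrite {1}e2 -/(B y) a0 !mul0r addr0.
Qed.

(** The segment leaves the cone through one of its rays. The level is affine, so it is at most [k]
    at the exit, which therefore lies on the edge and not beyond its end. *)
Lemma cross_arm x p : 0 < A x -> 0 < B x -> A p + B p <= A x + B x ->
  A x + B x <= k -> A p < 0 \/ B p < 0 ->
  exists2 y, on_seg x p y &
    (on_seg v u y /\ B y <= A x + B x) \/ (on_seg v w y /\ A y <= A x + B x).
Proof.
move=> ax bx sp sx.
(* Parameters at which the segment reaches the lines [A = 0] and [B = 0]; each is used only when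
   that coordinate is negative at [p]. *)
pose sa := A x / (A x - A p); pose sb := B x / (B x - B p).
have hu : A p < 0 -> 0 <= B x + sa * (B p - B x) -> exists2 y, on_seg x p y &
    (on_seg v u y /\ B y <= A x + B x) \/ (on_seg v w y /\ A y <= A x + B x).
  move=> ap bq; have d0 : 0 < A x - A p by lra.
  have dn : A x - A p != 0 by rewrite gt_eqF.
  have s01 : 0 <= sa <= 1.
    by rewrite /sa divr_ge0 ?(ltW ax) ?(ltW d0) //= ler_pdivrMr //; lra.
  have ay : A (pt_on x p sa) = 0 by rewrite A_pt /sa; field.
  have by_ : B (pt_on x p sa) <= A x + B x.
    have : sa * (A p + B p) <= sa * (A x + B x).
      by move/andP: s01 => [s0 _]; apply: ler_wpM2l.
    by move: ay; rewrite A_pt B_pt; lra.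
  exists (pt_on x p sa); first exact: on_seg_pt.
  left; split => //; apply: on_vu => //; rewrite B_pt in by_ *; rewrite bq /=; lra.
have hw : B p < 0 -> 0 <= A x + sb * (A p - A x) -> exists2 y, on_seg x p y &
    (on_seg v u y /\ B y <= A x + B x) \/ (on_seg v w y /\ A y <= A x + B x).
  move=> ap bq; have d0 : 0 < B x - B p by lra.
  have dn : B x - B p != 0 by rewrite gt_eqF.
  have s01 : 0 <= sb <= 1.
    by rewrite /sb divr_ge0 ?(ltW bx) ?(ltW d0) //= ler_pdivrMr //; lra.
  have ay : B (pt_on x p sb) = 0 by rewrite B_pt /sb; field.
  have by_ : A (pt_on x p sb) <= A x + B x.
    have : sb * (A p + B p) <= sb * (A x + B x).
      by move/andP: s01 => [s0 _]; apply: ler_wpM2l.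
    by move: ay; rewrite A_pt B_pt; lra.
  exists (pt_on x p sb); first exact: on_seg_pt.
  right; split => //; apply: on_vw => //; rewrite A_pt in by_ *; rewrite bq /=; lra.
have saE : 0 < A x - A p -> (0 <= B x + sa * (B p - B x)) = (0 <= B x * (A x - A p) + A x * (B p - B x)).
  move=> d; have dn : A x - A p != 0 by rewrite gt_eqF.
  rewrite -(pmulr_rge0 _ d); congr (0 <= _); rewrite /sa; field.
  exact: dn.
have sbE : 0 < B x - B p -> (0 <= A x + sb * (A p - A x)) = (0 <= A x * (B x - B p) + B x * (A p - A x)).
  move=> d; have dn : B x - B p != 0 by rewrite gt_eqF.
  rewrite -(pmulr_rge0 _ d); congr (0 <= _); rewrite /sb; field.
  exact: dn.
have [ap|ap] := ltP (A p) 0; have [bp|bp] := ltP (B p) 0; last by case; lra.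
(* Both coordinates change sign; this expression equals [A x * B p - B x * A p], whose sign tells
   which line is reached first. *)
- move=> _; have [h|h] := leP 0 (B x * (A x - A p) + A x * (B p - B x)).
    by apply: hu => //; rewrite saE //; lra.
  by apply: hw => //; rewrite sbE //; lra.
- move=> _; apply: hu => //; rewrite saE; last by lra.
  have : 0 <= B x * - A p by rewrite mulr_ge0; lra.
  have : 0 <= A x * B p by rewrite mulr_ge0; lra.
  by lra.
- move=> _; apply: hw => //; rewrite sbE; last by lra.
  have : 0 <= A x * - B p by rewrite mulr_ge0; lra.
  have : 0 <= B x * A p by rewrite mulr_ge0; lra.
  by lra.
Qed.

Lemma edge_avoids_v x c d : adj l c d -> on_seg c d x -> 0 < A x -> 0 < B x ->
  c <> v /\ d <> v.
Proof.
move=> cd h ax bx.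
have no y : adj l v y -> on_seg v y x -> False.
  move=> /nbr[] -> [t [_ e1 e2]].
    by move: ax; rewrite (A_affine e1 e2) cross_uu cross_vu subrr mulr0 addr0 ltxx.
  by move: bx; rewrite (B_affine e1 e2) cross_ww cross_vw subrr mulr0 addr0 ltxx.
by split=> ev; subst; [apply: (no d)|apply: (no c) => //; [exact: adjC|exact: on_segC]].
Qed.

(* An edge through [x] whose endpoint [p] is no further from [v] than [x], but
   outside the cone, has to cross one of the two edges at [v]. *)
Lemma low_endpoint x p d : adj l p d -> on_seg p d x -> 0 < A x -> 0 < B x ->
  A p + B p <= A x + B x -> A x + B x <= k -> 0 <= A p /\ 0 <= B p.
Proof.
move=> pd h ax bx sp sx.
have [pv dv] := edge_avoids_v pd h ax bx.
have [ap|ap] := leP 0 (A p); last first.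
all: have [bp|bp] := leP 0 (B p) => //; exfalso.
all: have [|y sy hy] := @cross_arm x p ax bx sp sx; first by auto.
all: have pdy : on_seg p d y by apply: (on_seg_trans h (on_segl _ _) sy).
(* The exit [y] is on an arm, so it is not [p], which is outside the cone; were it [d], then [x = d]
   would be on an arm too. So two edges meet in the interior of [p d], against simplicity. *)
all: have nyp : y <> p by
  (move=> ey; subst y; case: hy => -[[t [/andP[t0 t1] f1 f2]] _];
   move: (A_affine f1 f2) (B_affine f1 f2); rewrite ?cross_uu ?cross_vu ?cross_ww ?cross_vw ?A_w ?B_u => E1 E2;
   have := mulr_ge0 t0 (ltW k0); rewrite -/k; lra).
all: have nyd : y <> d by
  (move=> ey; subst y; have xd : x = d by [apply: (on_seg_ends (b := p)) => //; first [exact: (adj_neq sl (adjC pd))|exact: on_segC]];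
   subst x; case: hy => -[[t [/andP[t0 t1] f1 f2]] _];
   move: (A_affine f1 f2) (B_affine f1 f2); rewrite ?cross_uu ?cross_vu ?cross_ww ?cross_vw ?A_w ?B_u => E1 E2; lra).
all: by case: hy => -[hy _]; [case: (adj_touch sl vu pd hy pdy)|case: (adj_touch sl vw pd hy pdy)];
  move=> [? ?]; subst => //; tauto.
Qed.


(** An edge through [x] has an end whose level is at most that of [x]. By [low_endpoint] this end is
    in the cone, where no vertex other than [v] is so low. *)
Lemma empty_off x : 0 < A x -> 0 < B x -> A x + B x < k ->
  (forall z, z \in l -> z <> v -> 0 <= A z -> 0 <= B z -> A x + B x < A z + B z) ->
  ~ on_curve l x.
Proof.
move=> ax bx sx hx /on_curve_adj[c [d [cd h]]].
have no p q : adj l p q -> on_seg p q x -> A p + B p <= A x + B x -> False.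
  move=> pq hh sp; have [ap bp] := low_endpoint pq hh ax bx sp (ltW sx).
  have [pv _] := edge_avoids_v pq hh ax bx; have [pl _] := adj_mem pq.
  by have := hx p pl pv ap bp; lra.
have [sc|sc] := leP (A c + B c) (A x + B x); first exact: (no c d).
apply: (no d c); [exact: adjC|exact: on_segC|].
rewrite leNgt; apply/negP => sd.
case: h => t [t01 e1 e2]; have := conv_gt t01 sc sd.
by rewrite {1}(A_affine e1 e2) {1}(B_affine e1 e2); lra.
Qed.

(** Slide [x] towards [v] into the corner box. Outside the cone the box has parity 0, being joined
    there to a point below all vertices; were the parity 0 inside as well, no flip could occur near
    [v]. *)
Lemma par_inside x : 0 < A x -> 0 < B x ->
  (forall t, 0 < t <= 1 -> ~ on_curve l (pt_on v x t)) -> par l x.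
Proof.
move=> ax bx off; have [e0 _ _ _] := hK.
have [r /andP[r0 r1] hr] := small_step v (x.1 - v.1, x.2 - v.2) e0.
have by_ : box v e (pt_on v x r) by apply: hr; rewrite lexx ltW.
set y := pt_on v x r in by_.
have ny : ~ on_curve l y by apply: off; rewrite r0.
have ay : 0 < A y by rewrite A_pt cross_vu add0r subr0 mulr_gt0.
have by' : 0 < B y by rewrite B_pt cross_vw add0r subr0 mulr_gt0.
have -> : par l x = par l y.
  apply: par_seg => -[z [cz [t [/andP[t0 t1] e1 e2]]]].
  apply: (off (1 + t * (r - 1))).
    have : t * (1 - r) <= 1 * (1 - r) by apply: ler_wpM2r; lra.
    have : 0 <= t * (1 - r) by rewrite mulr_ge0; lra.
    by move=> *; apply/andP; split; lra.
  suff <- : z = pt_on v x (1 + t * (r - 1)) by [].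
  by rewrite (surjective_pairing z) e1 e2 /y /pt_on /=; congr pair; ring.
(* The direction is opposite to the cone. It points strictly down because [u] and [w] are not lower
   than [v] and, by [k0], not both at its height. *)
have [r' /andP[r0' _] hr'] := small_step v (2%:R * v.1 - u.1 - w.1, 2%:R * v.2 - u.2 - w.2) e0.
set f : R * R := (v.1 + r' * (2%:R * v.1 - u.1 - w.1), v.2 + r' * (2%:R * v.2 - u.2 - w.2)).
have bf : box v e f by apply: hr'; rewrite lexx ltW.
have Af : A f < 0.
  have -> : A f = - (r' * k) by rewrite /A /k /cross /f /=; ring.
  by rewrite oppr_lt0 mulr_gt0.
have [_ ul] := adj_mem vu; have [_ wl] := adj_mem vw.
have uv2 := low ul; have wv2 := low wl.
have f2 : f.2 < v.2.
  rewrite /f /= gtrDl pmulr_rlt0 //.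
  have [//|h] := ltP (2%:R * v.2 - u.2 - w.2) 0; exfalso.
  have e1 : u.2 = v.2 by lra.
  have e2 : w.2 = v.2 by lra.
  by move: k0; rewrite /cross e1 e2 !subrr mulr0 mul0r subrr ltxx.
have [nf pf] : ~ on_curve l f /\ par l f = false.
  by apply: below_out => z zl; apply: (lt_le_trans f2); apply: low.
apply/negPn/negP => /negbTE py.
have [vl _] := adj_mem vu.
have [z [z' [bz bz' nz nz' pz]]] := flip_near sl (mem_on_curve vl) e0.
have all0 p : box v e p -> ~ on_curve l p -> par l p = false.
  move=> bp np; have [[a1 b1]|o1] := corner_off hK k0 bp np.
    by rewrite -py; apply/par_joined/(corner_in_joined hK k0).
  by rewrite -pf; apply/par_joined/(corner_out_joined hK k0) => //; left.
by move: pz; rewrite !all0 ?eqxx.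
Qed.

Lemma diagonal_to_vertex z : z \in l -> 0 < A z -> 0 < B z -> A z + B z <= k ->
  (forall y, y \in l -> y <> v -> 0 <= A y -> 0 <= B y -> A z + B z <= A y + B y) ->
  inner_diagonal l v z.
Proof.
move=> zl az bz sz hz.
have off t : 0 < t < 1 -> ~ on_curve l (pt_on v z t).
  move=> /andP[t0 t1]; have aE : A (pt_on v z t) = t * A z by rewrite A_pt cross_vu; ring.
  have bE : B (pt_on v z t) = t * B z by rewrite B_pt cross_vw; ring.
  have ts : t * (A z + B z) < A z + B z by rewrite gtr_pMl //; lra.
  apply: empty_off; rewrite ?aE ?bE ?mulr_gt0 //; first lra.
  by move=> y yl yv ay by_; have := hz y yl yv ay by_; lra.
move=> t t01; split; first exact: off.
have /andP[t0 t1] := t01.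
apply: par_inside.
- by rewrite A_pt cross_vu add0r subr0 mulr_gt0.
- by rewrite B_pt cross_vw add0r subr0 mulr_gt0.
- move=> s /andP[s0 s1]; rewrite pt_on_pt; apply: off; rewrite mulr_gt0 //=.
  by apply: (le_lt_trans _ t1); rewrite ler_piMl // ltW.
Qed.

(** An edge through a point of level [k] between [u] and [w] must have both its ends at level [k],
    hence at [u] and [w], which are not adjacent. Points of lower level are handled by
    [empty_off]. *)
Lemma diagonal_ear : ~ adj l u w ->
  (forall y, y \in l -> y <> v -> y <> u -> y <> w -> 0 <= A y -> 0 <= B y ->
     k < A y + B y) -> inner_diagonal l u w.
Proof.
move=> nuw hy t t01; have /andP[t0 t1] := t01.
set x := pt_on u w t.
have aE : A x = t * k by rewrite A_pt cross_uu A_w; ring.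
have bE : B x = (1 - t) * k by rewrite B_pt cross_ww B_u; ring.
have ax : 0 < A x by rewrite aE mulr_gt0.
have bx : 0 < B x by rewrite bE mulr_gt0 // subr_gt0.
have sx : A x + B x = k by rewrite aE bE; ring.
have arms y : y \in l -> y <> v -> 0 <= A y -> 0 <= B y -> A y + B y <= k -> y = u \/ y = w.
  move=> yl yv ay by_ sy; have [->|/eqP yu] := eqVneq y u; first by left.
  have [->|/eqP yw] := eqVneq y w; first by right.
  by move: sy; rewrite leNgt hy.
have off : ~ on_curve l x.
  move=> /on_curve_adj[c [d [cd h]]].
  have no p q : adj l p q -> on_seg p q x -> A p + B p <= A x + B x -> p = u \/ p = w.
    move=> pq hh sp; have sx' : A x + B x <= k by rewrite sx.
    have [ap bp] := low_endpoint pq hh ax bx sp sx'.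
    have [pv _] := edge_avoids_v pq hh ax bx; have [pl _] := adj_mem pq.
    by apply: arms => //; rewrite -sx.
  have both p q : adj l p q -> on_seg p q x -> A p + B p <= A x + B x -> False.
    move=> pq hh sp; have pE := no _ _ pq hh sp.
    have spk : A p + B p = k.
      by case: pE => ->; rewrite ?cross_uu ?cross_ww ?A_w ?B_u ?add0r ?addr0.
    (* [x] and [p] have level [k] and differ, so [q] on the same line has level [k] as well. *)
    have qE : q = u \/ q = w.
      apply: (no q p); [exact: adjC|exact: on_segC|].
      case: (hh) => s [/andP[s0 s1] e1 e2].
      have eA := A_affine e1 e2; have eB := B_affine e1 e2.
      have sn : s <> 0.
        move=> s00; move: eA eB; rewrite s00 !mul0r !addr0 => eA eB.
        by case: pE => e'; move: ax bx; rewrite eA eB e' ?cross_uu ?cross_ww ltxx.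
      have sp0 : 0 < s by rewrite lt_neqAle s0 andbT eq_sym; apply/eqP.
      rewrite -(ler_pM2l sp0).
      have : s * (A q + B q) = A x + B x - (1 - s) * (A p + B p) by rewrite {1}eA {1}eB; ring.
      by rewrite sx spk => ->; lra.
    have npq := adj_neq sl pq.
    case: pE qE => ep [] eq_; subst p q => //.
    by apply: nuw; apply: adjC.
  have [sc|sc] := leP (A c + B c) (A x + B x); first exact: (both c d).
  apply: (both d c); [exact: adjC|exact: on_segC|].
  rewrite leNgt; apply/negP => sd.
  case: h => s [s01 e1 e2]; have := conv_gt s01 sc sd.
  by rewrite {1}(A_affine e1 e2) {1}(B_affine e1 e2); lra.
split => //; apply: par_inside => // s /andP[s0]; rewrite le_eqVlt.
move=> /orP[/eqP ->|s1]; first by rewrite pt_on1.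
have saE : A (pt_on v x s) = s * A x by rewrite A_pt cross_vu; ring.
have sbE : B (pt_on v x s) = s * B x by rewrite B_pt cross_vw; ring.
have ss : s * (A x + B x) < k by rewrite sx gtr_pMl.
apply: empty_off; rewrite ?saE ?sbE ?mulr_gt0 //; first lra.
move=> y yl yv ay by_; rewrite -mulrDr; apply: (lt_le_trans ss).
by rewrite leNgt; apply/negP => sy; case: (arms y yl yv ay by_ (ltW sy)) => ey;
  move: sy; rewrite ey ?cross_uu ?cross_ww ?A_w ?B_u ?add0r ?addr0 ltxx.
Qed.

Lemma lowest_diagonal : ~ adj l u w -> exists x z,
  [/\ x \in l, z \in l, x <> z, ~ adj l x z & inner_diagonal l x z].
Proof.
move=> nuw; have [vl ul] := adj_mem vu; have [_ wl] := adj_mem vw.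
have uw : u <> w by move=> e'; move: k0; rewrite e' /cross mulrC subrr ltxx.
pose C := [seq y <- l | [&& y != v, y != u, y != w, 0 <= A y, 0 <= B y & A y + B y <= k]].
have [C0|/(seq_argmin (fun y => A y + B y))[z]] := eqVneq C [::].
  exists u, w; split => //; apply: diagonal_ear => // y yl /eqP yv /eqP yu /eqP yw ay by_.
  rewrite ltNge; apply/negP => sy.
  have : y \in C by rewrite mem_filter yl yv yu yw ay by_ sy.
  by rewrite C0.
rewrite mem_filter => /andP[/and5P[/eqP zv /eqP zu /eqP zw az /andP[bz sz]] zl] hz.
(* On an arm, [z] would be a vertex inside an edge. *)
have az' : 0 < A z.
  rewrite lt_neqAle az andbT eq_sym; apply/eqP => a0.
  have : on_seg v u z by apply: on_vu => //; rewrite bz /=; lra.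
  by move/(vertex_on_edge sl vu zl) => [].
have bz' : 0 < B z.
  rewrite lt_neqAle bz andbT eq_sym; apply/eqP => b0.
  have : on_seg v w z by apply: on_vw => //; rewrite az /=; lra.
  by move/(vertex_on_edge sl vw zl) => [].
exists v, z; split => //; first by move=> e'; apply: zv.
  by move/nbr => [].
have arms y : y = u \/ y = w -> A z + B z <= A y + B y.
  by case=> ->; rewrite ?cross_uu ?cross_ww ?A_w ?B_u ?add0r ?addr0.
have min y : y \in l -> y <> v -> 0 <= A y -> 0 <= B y -> A z + B z <= A y + B y.
  move=> yl /eqP yv ay by_.
  have [->|yu] := eqVneq y u; first by apply: arms; left.
  have [->|yw] := eqVneq y w; first by apply: arms; right.
  have [sy|/ltW sy] := leP (A y + B y) k; last exact: le_trans sz sy.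
  by apply: hz; rewrite mem_filter yl yv yu yw ay by_ sy.
exact: diagonal_to_vertex.
Qed.

End LowestCorner.
End Ear.

(** * Triangulating *)

Section Triangle.
Variable R : realType.
Implicit Types (a b c d p q x y z v w u : R * R) (l s : seq (R * R)).

Lemma three_cycle_size l u v w : simple l -> (u, v) \in edges l ->
  (v, w) \in edges l -> adj l u w -> size l = 3%N.
Proof.
move=> sl uv vw [uw|wu].
  have [ul _ _] := sl; have e := edges_inj1 ul uv uw; subst w.
  by case: (simple_neq sl vw).
have [vl _] := edgesP vw; have [k s e] := rot_to vl.
move: (simple_rot k sl); rewrite -(size_rot k l) e.
rewrite -!(perm_mem (edges_rot k l)) e in uv vw wu.
case: s {e} uv vw wu => [|w' [|u' [|y s]]] uv vw wu // [us _ _] //.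
have vw' : (v, w') \in edges [:: v, w', u', y & s] by rewrite mem_head.
have e := edges_inj1 us vw vw'; subst w'.
have wu' : (w, u') \in edges [:: v, w, u', y & s] by rewrite inE mem_head orbT.
have e := edges_inj1 us wu wu'; subst u'.
have uy : (u, y) \in edges [:: v, w, u, y & s] by rewrite inE in_cons mem_head !orbT.
have e := edges_inj1 us uv uy; subst y.
by move: us; rewrite /= !inE eqxx !orbT.
Qed.

Lemma lowest_corner l : simple l -> exists v u w e,
  [/\ adj l v u, adj l v w & forall d, adj l v d -> d = u \/ d = w] /\
  [/\ corner (on_curve l) v u w e, forall x, x \in l -> v.2 <= x.2,
     0 < cross v w u & adj l u w -> size l = 3%N].
Proof.
move=> sl; have [ul sz _] := sl.
have [|v vl low] := @exists_lowest R l; first by case: (l) sz.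
have low2 x : x \in l -> v.2 <= x.2 by move/low => [/ltW //|[-> _]].
have [w vw] := edges_next vl; have [u uv] := edges_prev vl.
have [e ce] := corner_vertex sl uv vw.
have nbr d : adj l v d -> d = u \/ d = w.
  by case=> vd; [right; apply: edges_inj1 vd vw|left; apply: edges_inj2 vd uv].
have sz3 := three_cycle_size sl uv vw.
have vu' : adj l v u by right.
have vw' : adj l v w by left.
case: (spread_vertex sl uv vw) => [|[g [g0 wv e1 e2]]].
  rewrite neq_lt => /orP[k0|k0]; last by exists v, u, w, e.
  exists v, w, u, e; split; split => //.
  - by move=> d /nbr[]; auto.
  - exact: cornerC.
  - by move: k0; rewrite /cross => k0; lra.
  - by move/adjC.
(* A straight angle at [v] forces [u] and [w] to the height of [v], on opposite sides; neither can
   be to the left by the choice of [v]. *)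
exfalso; apply: wv.
have [_ wl] := edgesP vw; have [ul' _] := edgesP uv.
have w2 : w.2 = v.2.
  have := low2 _ wl; have := low2 _ ul'; rewrite le_eqVlt => uv2; rewrite le_eqVlt.
  move=> /orP[/eqP //|h]; exfalso.
  have : g * (w.2 - v.2) > 0 by rewrite mulr_gt0 // subr_gt0.
  by case/orP: uv2 => [/eqP|] ?; lra.
have u2 : u.2 = v.2 by move: e2; rewrite w2 subrr mulr0; lra.
have w1 : v.1 <= w.1 by case: (low _ wl) => [|[]//]; rewrite w2 ltxx.
have u1 : v.1 <= u.1 by case: (low _ ul') => [|[]//]; rewrite u2 ltxx.
have w1' : w.1 = v.1.
  apply/eqP; rewrite eq_le w1 andbT leNgt; apply/negP => h.
  have : g * (w.1 - v.1) > 0 by rewrite mulr_gt0 // subr_gt0.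
  by lra.
by rewrite (surjective_pairing w) w1' w2 -surjective_pairing.
Qed.

(** The list is not rotated, so that the sizes of [p] and [s1] are the indices that [cuts]
    enumerates. Both parts between the ends are nonempty because the ends are not adjacent. *)
Lemma exists_split l : simple l -> (3 < size l)%N -> exists (p : seq (R * R)) x s1 z s2,
  [/\ l = p ++ x :: s1 ++ z :: s2, s1 != [::], s2 ++ p != [::] &
    inner_diagonal l x z].
Proof.
move=> sl sz; have [v [u [w [e [[vu vw nbr] [ce low k0 sz3]]]]]] := lowest_corner sl.
have nuw : ~ adj l u w by move/sz3 => s3; rewrite s3 in sz.
have [x [z [xl zl xz nadj dg]]] := lowest_diagonal sl vu vw nbr ce low k0 nuw.
have split_at a b (p s : seq (R * R)) : l = p ++ a :: s -> b \in s -> ~ adj l a b ->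
    inner_diagonal l a b -> exists (p : seq (R * R)) x s1 z s2,
  [/\ l = p ++ x :: s1 ++ z :: s2, s1 != [::], s2 ++ p != [::] &
    inner_diagonal l x z].
  move=> el bs nab dab; case/splitPr: bs el => s1 s2 el.
  exists p, a, s1, b, s2; split => //; apply/eqP => s0; apply: nab.
    left; rewrite -(perm_mem (edges_rot (size p) l)) el rot_size_cat s0.
    by rewrite mem_head.
  right; rewrite -(perm_mem (edges_rot (size p) l)) el rot_size_cat cat_cons.
  by rewrite -catA cat_cons s0 edges_cat mem_cat mem_head orbT.
have [p [s el]] : exists p s : seq (R * R), l = p ++ x :: s.
  by case/splitPr: xl => p s; exists p, s.
have : z \in p ++ x :: s by rewrite -el.
rewrite mem_cat inE => /or3P[zp|/eqP zx|zs]; last exact: (split_at x z p s).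
- case/splitPr: zp el => p1 p2; rewrite -catA cat_cons => el.
  apply: (split_at z x p1 (p2 ++ x :: s)) => //.
  + by rewrite mem_cat mem_head orbT.
  + by move/adjC.
  + exact: diagonalC.
- by case: xz.
Qed.

Section TriangleCorner.
Variables (l : seq (R * R)) (v u w : R * R) (e : R).
Hypotheses (sl : simple l) (vu : adj l v u) (vw : adj l v w) (uw : adj l u w).
Hypothesis nbr : forall d, adj l v d -> d = u \/ d = w.
Hypothesis hK : corner (on_curve l) v u w e.
Hypothesis low : forall x, x \in l -> v.2 <= x.2.
Hypothesis k0 : 0 < cross v w u.
Hypothesis all3 : forall x, x \in l -> [\/ x = v, x = u | x = w].

Definition in_triangle x := [/\ 0 <= cross v x u, 0 <= cross v w x &
  cross v x u + cross v w x <= cross v w u].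

Lemma in_triangle_vertex x : x \in l -> in_triangle x.
Proof.
have kk := ltW k0; rewrite /in_triangle.
move/all3 => [] ->.
- by rewrite cross_vu cross_vw addr0.
- by rewrite cross_uu add0r.
- by rewrite cross_ww addr0.
Qed.

Lemma in_triangle_convex x y z : in_triangle x -> in_triangle y -> on_seg x y z ->
  in_triangle z.
Proof.
move=> [a1 a2 a3] [b1 b2 b3] [t [/andP[t0 t1] e1 e2]].
rewrite /in_triangle (cross_affine1 v u e1 e2) (cross_affine2 v w e1 e2).
have t1' : 0 <= 1 - t by lra.
split.
- have := mulr_ge0 t1' a1; have := mulr_ge0 t0 b1; lra.
- have := mulr_ge0 t1' a2; have := mulr_ge0 t0 b2; lra.
- have := ler_wpM2l t1' a3; have := ler_wpM2l t0 b3; lra.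
Qed.

Lemma in_triangle_region x : in_triangle x -> region l x.
Proof.
move=> [ax bx sx].
have [a0|an] := eqVneq (cross v x u) 0.
  left; apply/on_curve_adj; exists v, u; split => //.
  by apply: (on_vu (w := w)) => //; rewrite bx /=; lra.
have [b0|bn] := eqVneq (cross v w x) 0.
  left; apply/on_curve_adj; exists v, w; split => //.
  by apply: (on_vw (u := u)) => //; rewrite ax /=; lra.
have ax' : 0 < cross v x u by rewrite lt_neqAle eq_sym an.
have bx' : 0 < cross v w x by rewrite lt_neqAle eq_sym bn.
move: sx; rewrite le_eqVlt => /orP[/eqP sk|sk].
  left; apply/on_curve_adj; exists u, w; split => //.
  have kn : cross v w u != 0 by rewrite gt_eqF.
  have [e1 e2] := cross_coord x kn.
  have bE : cross v w x = cross v w u - cross v x u by lra.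
  exists (cross v x u / cross v w u); split.
  - by rewrite divr_ge0 ?(ltW k0) //= ler_pdivrMr // mul1r; lra.
  - by rewrite {1}e1 bE; field.
  - by rewrite {1}e2 bE; field.
right; apply: (par_inside sl vu vw hK low k0) => // t /andP[t0 t1].
have aE : cross v (pt_on v x t) u = t * cross v x u.
  by rewrite A_pt cross_vu; ring.
have bE : cross v w (pt_on v x t) = t * cross v w x.
  by rewrite B_pt cross_vw; ring.
have sE : t * (cross v x u + cross v w x) < cross v w u.
  apply: le_lt_trans sk; rewrite ler_piMl // ltW // addr_gt0 //.
apply: (empty_off sl vu vw nbr hK low k0); rewrite ?aE ?bE ?mulr_gt0 //; first lra.
move=> z /all3[] -> // _ _ _; rewrite -mulrDr ?cross_uu ?cross_ww ?add0r ?addr0 //.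
Qed.

(** A point violating one of the three inequalities is separated from all vertices by a parallel to
    the corresponding side, so [halfplane_out] gives parity 0. *)
Lemma region_in_triangle x : region l x -> in_triangle x.
Proof.
case=> [[a [b [ab h]]]|px].
  by have [al bl] := edgesP ab; apply: in_triangle_convex h; apply: in_triangle_vertex.
have l0 : l != [::] by have [] := adj_mem vu; case: (l).
have out (c1 c2 : R) : (forall v, v \in l -> c1 * v.1 + c2 * v.2 < c1 * x.1 + c2 * x.2) ->
    False.
  by move/(halfplane_out l0) => [_]; rewrite px.
split; rewrite leNgt; apply/negP => h.
- apply: (out (v.2 - u.2) (u.1 - v.1)) => z /in_triangle_vertex[+ _ _].
  by move: h; rewrite /cross => *; lra.
- apply: (out (w.2 - v.2) (v.1 - w.1)) => z /in_triangle_vertex[_ + _].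
  by move: h; rewrite /cross => *; lra.
- apply: (out (u.2 - w.2) (w.1 - u.1)) => z /in_triangle_vertex[_ _ +].
  by move: h; rewrite /cross => *; lra.
Qed.

End TriangleCorner.

Lemma triangle_sees l g q y : simple l -> size l = 3%N -> g \in l -> region l q ->
  on_seg g q y -> region l y.
Proof.
move=> sl sz gl rq h.
have [v [u [w [e [[vu vw nbr] [ce low k0 _]]]]]] := lowest_corner sl.
have [vl ul] := adj_mem vu; have [_ wl] := adj_mem vw.
have nvu := adj_neq sl vu; have nvw := adj_neq sl vw.
have nuw : u <> w by move=> e'; move: k0; rewrite e' /cross mulrC subrr ltxx.
have all3 x : x \in l -> [\/ x = v, x = u | x = w].
  have us : uniq [:: v; u; w] by rewrite /= !inE negb_or; apply/and3P; split => //;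
    [apply/andP; split|]; apply/eqP.
  have sub : {subset [:: v; u; w] <= l} by move=> z; rewrite !inE => /or3P[]/eqP->.
  have [] := uniq_min_size us sub; first by rewrite sz.
  by move=> _ e'; rewrite -e' !inE => /or3P[]/eqP->; [constructor 1|constructor 2|constructor 3].
have uw : adj l u w.
  have [z uz] := edges_next ul; have [z' z'u] := edges_prev ul.
  have [_ zl] := edgesP uz; have [z'l _] := edgesP z'u.
  have nzu := simple_neq sl uz; have nz'u := simple_neq sl z'u.
  case: (all3 _ zl) => ez; subst z => //; last by left.
  case: (all3 _ z'l) => ez'; subst z' => //; last by right.
  by case: (simple_no_2cycle sl uz z'u).
apply: (in_triangle_region sl vu vw uw nbr ce low k0 all3).
apply: in_triangle_convex h; last exact: (region_in_triangle vu k0 all3).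
exact: (in_triangle_vertex k0 all3).
Qed.

End Triangle.

(** * Enumeration of triangulations and the finite check *)

(** The cut joins positions [i] and [i + k + 1], with [k] vertices strictly between them. The filter
    leaves at least one vertex on the other side, whose piece wraps around the end of the list. *)
Definition cuts (T : Type) (l : seq T) : seq (seq T * seq T) :=
  [seq (take k.+2 (drop i l), drop (i + k).+1 l ++ take i.+1 l) |
     i <- iota 0 (size l),
     k <- [seq k <- iota 1 (size l - i - 2) | (k.+2 < size l)%N]].

(* [good_starts] ranges over the triangulations of the cyclic list [l] obtained
   by repeated cuts, and lists for each of them the starts [s] whose guards hit
   all its triangles. *)
Fixpoint good_starts (U : eqType) (T : Type) (starts : seq U) (hit : U -> seq T -> bool)
    (m : nat) (l : seq T) : seq (seq U) :=
  if m is m'.+1 then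
    if size l == 3%N then [:: [seq s <- starts | hit s l]] else
    undup (flatten [seq [seq [seq s <- a | s \in b] |
        a <- good_starts starts hit m' c.1, b <- good_starts starts hit m' c.2] |
        c <- cuts l])
  else [::].

(** The list holds labels, placed by [f], so that the enumeration can be computed without reals. [a]
    does not depend on [q]: it belongs to one triangulation, whose triangles cover the region. *)
Lemma good_starts_see (R : realType) (U T : eqType) (starts : seq U)
    (hit : U -> seq T -> bool) (f : T -> R * R) (m : nat) (l : seq T) :
  simple (map f l) -> (size l <= m)%N ->
  exists2 a, a \in good_starts starts hit m l & forall q, region (map f l) q ->
    exists tri, (forall s, s \in a -> hit s tri) /\
      (forall g, g \in tri -> forall y, on_seg (f g) q y -> region (map f l) y).
Proof.
elim: m l => [|m IH] l sl lm.
  by have [_] := sl; rewrite size_map; case: (size l) lm.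
have [_ sz _] := sl; rewrite size_map in sz.
rewrite /=; have [s3|n3] := eqVneq (size l) 3%N.
  exists [seq s <- starts | hit s l]; rewrite ?mem_head // => q rq; exists l; split.
    by move=> s; rewrite mem_filter => /andP[].
  by move=> g gl y h; apply: triangle_sees h; rewrite ?size_map ?map_f.
have sz4 : (3 < size (map f l))%N by rewrite size_map ltn_neqAle eq_sym n3.
have [p [x [s1 [z [s2 [es n1 n2 dg]]]]]] := exists_split sl sz4.
have rE : rot (size p) (map f l) = x :: s1 ++ z :: (s2 ++ p).
  by rewrite es rot_size_cat cat_cons -catA cat_cons.
have sr := simple_rot (size p) sl; rewrite rE in sr.
have dr : inner_diagonal (x :: s1 ++ z :: (s2 ++ p)) x z.
  by rewrite -rE; apply: diagonal_rot.
have rotE q : region (x :: s1 ++ z :: (s2 ++ p)) q <-> region (map f l) q.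
  by rewrite -rE /region par_rot on_curve_rot.
have szE : size l = (size p + (size s1 + size s2).+2)%N.
  by rewrite -(size_map f) es !size_cat /= size_cat /=; lia.
have sz1 : (0 < size s1)%N by rewrite lt0n size_eq0.
have sz2 : (0 < size s2 + size p)%N by rewrite -size_cat lt0n size_eq0.
pose c1 := take (size s1).+2 (drop (size p) l).
pose c2 := drop (size p + size s1).+1 l ++ take (size p).+1 l.
have e1 : map f c1 = x :: rcons s1 z.
  rewrite /c1 map_take map_drop es drop_size_cat //.
  by rewrite -cat_rcons -cat_cons take_size_cat //= size_rcons.
have e2 : map f c2 = z :: rcons (s2 ++ p) x.
  have d : drop (size p + size s1).+1 (map f l) = z :: s2.
    by rewrite es -cat_cons catA drop_size_cat // size_cat /= addnS.
  have t : take (size p).+1 (map f l) = rcons p x.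
    by rewrite es -cat_rcons take_size_cat ?size_rcons.
  by rewrite /c2 map_cat map_drop map_take d t /= rcons_cat.
have sr1 : simple (map f c1) by rewrite e1; apply: split_simple n1 dr.
(* Rotating exchanges the roles of the pieces, so facts on the first one serve for the second. *)
have rot2 : z :: (s2 ++ p) ++ x :: s1 = rot (size (x :: s1)) (x :: s1 ++ z :: (s2 ++ p)).
  by rewrite -cat_cons rot_size_cat.
have sr' : simple (z :: (s2 ++ p) ++ x :: s1) by rewrite rot2; exact: simple_rot.
have dr' : inner_diagonal (z :: (s2 ++ p) ++ x :: s1) z x.
  by rewrite rot2; apply/diagonal_rot/diagonalC.
have sr2 : simple (map f c2) by rewrite e2; apply: split_simple n2 dr'.
have [|a aP h1] := IH c1 sr1.
  by rewrite -(size_map f) e1 /= size_rcons; move: lm; rewrite szE; lia.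
have [|b bP h2] := IH c2 sr2.
  by rewrite -(size_map f) e2 /= size_rcons size_cat; move: lm; rewrite szE; lia.
exists [seq s <- a | s \in b].
  rewrite mem_undup; apply/flattenP.
  exists [seq [seq s <- a | s \in b] | a <- good_starts starts hit m c1,
     b <- good_starts starts hit m c2]; last by apply/allpairsP; exists (a, b).
  apply/mapP; exists (c1, c2) => //.
  apply/allpairsPdep; exists (size p), (size s1); split => //.
  - by rewrite mem_iota szE; lia.
  - by rewrite mem_filter mem_iota szE; lia.
move=> q; rewrite -rotE => rq.
have incl1 y : region (map f c1) y -> region (map f l) y.
  by rewrite e1 -rotE; exact: split_region1.
have incl2 y : region (map f c2) y -> region (map f l) y.
  rewrite e2 -rotE => /(split_region1 sr' n2 n1 dr').
  by rewrite /region rot2 par_rot on_curve_rot.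
have [r1|r2] : region (map f c1) q \/ region (map f c2) q.
  rewrite e1 e2; case: rq => [|pq].
    by move/split_curve => []; [left; left|right; left].
  move: pq; rewrite split_par /region; case: (par (x :: rcons s1 z) q) => /= pq.
    by left; right.
  by right; right.
- have [tri [ht hs]] := h1 q r1; exists tri; split.
    by move=> s; rewrite mem_filter => /andP[_ /ht].
  by move=> g gs y h; apply/incl1/(hs g).
- have [tri [ht hs]] := h2 q r2; exists tri; split.
    by move=> s; rewrite mem_filter => /andP[/ht].
  by move=> g gs y h; apply/incl2/(hs g).
Qed.

(** Three values of k are enough, as 3k < n <= 8. *)
Definition third_hits (n s : nat) (tri : seq nat) : bool :=
  has (fun k => (3 * k < n)%N && (((s + 3 * k) %% n)%N \in tri)) (iota 0 3).

Lemma good_starts_small (n : nat) : (3 <= n <= 8)%N ->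
  [::] \notin good_starts (iota 0 n) (third_hits n) n (iota 0 n).
Proof.
move=> n38.
(* An empty entry would be a triangulation without a common start; the six values of [n] are settled
   by one closed computation. *)
suff : all (fun n => [::] \notin good_starts (iota 0 n) (third_hits n) n (iota 0 n))
    (iota 3 6) by move/allP; apply; rewrite mem_iota.
by vm_compute.
Qed.

(** * From the region of the definition to the parity *)

Section Region.
Variable R : realType.
Implicit Types (a b c d q x y z v w u : R * R) (l : seq (R * R)).

Lemma segmentE a b : segment a b = on_seg a b.
Proof.
apply/seteqP; split => [x [t /= t01 <-]|x [t [t01 e1 e2]]].
  by move: t01; rewrite in_itv /= => t01; exists t; split => //=;
    rewrite /seg_point /= /GRing.scale /=; ring.
exists t; first by rewrite /= in_itv.
by rewrite (surjective_pairing x) e1 e2 /seg_point; congr pair;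
  rewrite /= /GRing.scale /=; ring.
Qed.

Lemma on_seg_connected a b : connected (on_seg a b : set (R * R)).
Proof.
rewrite on_seg_image; apply: connected_continuous_connected.
  exact: segment_connected.
by apply: continuous_subspaceT; exact: pt_on_continuous.
Qed.

Lemma joined_component (K : set (R * R)) x y : ~ K x -> joined K x y ->
  connected_component (~` K) x y.
Proof.
move=> nx; elim=> [|y' z _ IH h]; first exact: connected_component_refl.
apply: connected_component_trans IH _.
apply: (@connected_component_max _ _ (on_seg y' z)); [exact: on_segl|exact: h| |exact: on_segr].
exact: on_seg_connected.
Qed.

Lemma par_open l (c : bool) : open [set x | ~ on_curve l x /\ par l x = c].
Proof.
rewrite openE => x [nx px]; have [e e0 he] := box_off_curve nx.
apply/nbhs_ballP; exists e => //= y [y1 y2].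
have bxy : box x e y.
  by move: y1 y2; rewrite /ball /= !ltr_distlC => /andP[? ?] /andP[? ?]; split; apply/andP; split; lra.
split; first exact: he.
rewrite -px; apply: par_seg => -[w [cw /on_segC sw]]; apply: (he w) => //.
by apply: box_convex sw => //; exact: box_center.
Qed.

(** Off the curve the two parity classes are open, so each is also relatively closed. *)
Lemma par_connected l (C : set (R * R)) x y : connected C -> C `<=` ~` (on_curve l) ->
  C x -> C y -> par l x = par l y.
Proof.
move=> cC Coff Cx Cy.
pose P := C `&` [set z | ~ on_curve l z /\ par l z = par l x].
suff E : P = C by have : P y by [rewrite E]; case=> _ [].
apply: cC.
- by exists x; split => //; split => //; exact: Coff.
- by exists [set z | ~ on_curve l z /\ par l z = par l x] => //; exact: par_open.
- exists (~` [set z | ~ on_curve l z /\ par l z = ~~ par l x]).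
    by apply: open_closedC; exact: par_open.
  apply/seteqP; split => z [Cz].
    by move=> [_ pz]; split => // -[_]; rewrite pz; case: (par l x).
  move=> h; split => //; split; first exact: Coff.
  have [//|/eqP pz] := eqVneq (par l z) (par l x); case: h; split; first exact: Coff.
  by case: (par l z) (par l x) pz => [] [].
Qed.

Lemma vertices_bounded l : exists M : R, forall v, v \in l -> `|v.1| < M /\ `|v.2| < M.
Proof.
elim: l => [|v l [M hM]]; first by exists 0.
exists (Num.max M (Num.max `|v.1| `|v.2| + 1)) => w; rewrite inE !lt_max.
move=> /orP[/eqP ->|/hM[-> ->]//].
have m1 : `|v.1| <= Num.max `|v.1| `|v.2| by rewrite le_max lexx.
have m2 : `|v.2| <= Num.max `|v.1| `|v.2| by rewrite le_max lexx orbT.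
by split; apply/orP; right; lra.
Qed.

Lemma par_bounded l : l != [::] -> exists M : R, forall q, ~ on_curve l q -> par l q ->
  `|q| <= M.
Proof.
move=> l0; have [M hM] := vertices_bounded l; exists M => q nq pq.
have out (c1 c2 : R) : (forall v, v \in l -> c1 * v.1 + c2 * v.2 < c1 * q.1 + c2 * q.2) -> False.
  by move/(halfplane_out l0) => [_]; rewrite pq.
rewrite prod_normE ge_max !ler_norml; apply/andP; split; apply/andP; split;
  rewrite leNgt; apply/negP => h.
- by apply: (out (-1) 0) => v /hM[]; rewrite ltr_norml => /andP[? ?] _; lra.
- by apply: (out 1 0) => v /hM[]; rewrite ltr_norml => /andP[? ?] _; lra.
- by apply: (out 0 (-1)) => v /hM[_]; rewrite ltr_norml => /andP[? ?]; lra.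
- by apply: (out 0 1) => v /hM[_]; rewrite ltr_norml => /andP[? ?]; lra.
Qed.

(** A component of parity 1 stays within the bounds of the vertices; from parity 0, [jordan] leads
    to points arbitrarily far down. *)
Lemma par_bounded_component l q : simple l -> ~ on_curve l q ->
  par l q <-> bounded_set (connected_component (~` (on_curve l)) q).
Proof.
move=> sl nq; have l0 : l != [::] by case: sl => _; case: (l).
split=> [pq|[N [_ hN]]].
  have [M hM] := par_bounded l0.
  exists M; split; first exact: num_real.
  move=> M' MM' x Cx; apply: le_trans (ltW MM').
  have Coff := @connected_component_sub _ (~` (on_curve l)) q.
  apply: hM; first exact: Coff.
  have Cq : connected_component (~` (on_curve l)) q q by exact: connected_component_refl.
  by rewrite -(par_connected (@component_connected _ _ _) Coff Cq Cx).
apply/negPn/negP => /negbTE npq.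
have [f hf] := exists_below l.
(* Below every vertex, and with norm beyond the bound [N + 1] that boundedness gives on the
   component. *)
pose g : R * R := (0, Num.min f.2 (- (`|N| + 2))).
have gf : g.2 <= f.2 by rewrite /g /= ge_min lexx.
have gN : g.2 <= - (`|N| + 2) by rewrite /g /= ge_min lexx orbT.
have [ng pg] : ~ on_curve l g /\ par l g = false.
  by apply: below_out => v /hf; apply: le_lt_trans.
have j : joined (on_curve l) q g by apply: jordan; rewrite ?npq.
have := hN (N + 1) _ g (joined_component nq j).
rewrite /= prod_normE ge_max => /(_ _)/andP[]; first by rewrite ltrDl.
move=> _; rewrite ler_norml => /andP[h _].
by have := ler_norm N; lra.
Qed.

End Region.

(** * From vertices indexed modulo n to cyclic lists *)

Lemma edges_map (T U : Type) (f : T -> U) (l : seq T) :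
  edges (map f l) = [seq (f e.1, f e.2) | e <- edges l].
Proof.
case: l => //= x s; rewrite -map_rcons; move: (rcons s x) => r {s}.
by elim: r x => //= y r IH x; rewrite IH.
Qed.

Lemma edges_iota (n i j : nat) : (3 <= n <= 8)%N ->
  ((i, j) \in edges (iota 0 n)) = (i < n)%N && (j == i.+1 %% n)%N.
Proof.
move=> n38.
have A : all (fun n => (size (edges (iota 0 n)) == n) && all (fun e => (e.1 < n)%N && (e.2 == e.1.+1 %% n)%N)
   (edges (iota 0 n))) (iota 3 6) by vm_compute.
have B : all (fun n => all (fun i => (i, i.+1 %% n)%N \in edges (iota 0 n)) (iota 0 n)) (iota 3 6).
  by vm_compute.
have nI : n \in iota 3 6 by rewrite mem_iota.
move/allP: A => /(_ n nI)/andP[_ /allP A]; move/allP: B => /(_ n nI)/allP B.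
apply/idP/idP => [/A //|/andP[il /eqP ->]].
by apply: (B i); rewrite mem_iota.
Qed.

Section Main.
Variables (R : realType) (n : nat) (p : 'Z_n -> R * R).
Hypotheses (hn : (3 <= n <= 8)%N) (hp : simple_polygonal_curve p).
Let f (i : nat) : R * R := p (i%:R).
Let l := map f (iota 0 n).

Lemma n_gt1 : (1 < n)%N. Proof. by case/andP: hn; lia. Qed.

Lemma natr_valZ (i : 'Z_n) : (i : nat)%:R = i :> 'Z_n.
Proof. exact: natr_Zp. Qed.

Lemma polygon_edgeP a b : (a, b) \in edges l -> exists i : 'Z_n, a = p i /\ b = p (i + 1).
Proof.
rewrite /l edges_map => /mapP[[i j] /=]; rewrite edges_iota // => /andP[_ /eqP ->] [-> ->].
exists i%:R; split => //; rewrite /f Zp_nat_mod ?n_gt1 //; congr p.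
by rewrite -natr1.
Qed.

Lemma polygon_edge (i : 'Z_n) : (p i, p (i + 1)) \in edges l.
Proof.
have il : (i < n)%N by rewrite -{2}(Zp_cast n_gt1).
rewrite /l edges_map; apply/mapP; exists (i : nat, (i.+1 %% n)%N).
  by rewrite edges_iota // il eqxx.
rewrite /= /f Zp_nat_mod ?n_gt1 // natr_valZ; congr (_, p _).
by rewrite -natr1 natr_valZ.
Qed.

Lemma seg_point_pt a b (t : R) : seg_point a b t = pt_on a b t.
Proof. by rewrite /seg_point /pt_on; congr pair; rewrite /= /GRing.scale /=; ring. Qed.

Lemma polygon_simple : simple l.
Proof.
split.
- rewrite map_inj_in_uniq ?iota_uniq // => i j; rewrite !mem_iota /= => iln jln fij.
  have t00 : (0 : R) <= (0 : R) < (1 : R) by rewrite lexx ltr01.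
  have [|e _] := hp (i := i%:R) (j := j%:R) t00 t00.
    by rewrite !seg_point_pt !pt_on0.
  by move/(congr1 val): e; rewrite /= !val_Zp_nat ?n_gt1 // !modn_small.
- by rewrite size_map size_iota; case/andP: hn.
- move=> a b c d x /polygon_edgeP[i [-> ->]] /polygon_edgeP[j [-> ->]].
  move=> [t [t01 e1 e2]] [u [u01 g1 g2]].
  have [|-> _ //] := hp (i := i) (j := j) t01 u01.
  by rewrite !seg_point_pt /pt_on -e1 -e2 -g1 -g2.
Qed.

Lemma polygonal_curveE : polygonal_curve p = on_curve l.
Proof.
apply/seteqP; split => x.
  move=> [i _]; rewrite segmentE => h; exists (p i), (p (i + 1)); split => //.
  exact: polygon_edge.
move=> [a [b [/polygon_edgeP[i [-> ->]] h]]]; exists i => //.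
by rewrite segmentE.
Qed.

Lemma polygonE : polygon p = region l.
Proof.
apply/seteqP; split => q; rewrite /polygon polygonal_curveE.
  case=> [h|[nq /(par_bounded_component polygon_simple nq)]]; [by left|by right].
have [cq|nq] := pselect (on_curve l q); first by left.
by case=> // pq; right; split => //; apply/(par_bounded_component polygon_simple nq).
Qed.

End Main.

Theorem theorem1 (R : realType) (n : nat) (hn : (3 <= n <= 8)%N)
    (p : 'Z_n -> R * R) (hp : simple_polygonal_curve p) :
  exists (s : 'Z_n) (eps : int), (eps = 1 \/ eps = -1) /\
    forall q : R * R, polygon p q ->
      exists k : nat, (3 * k < n)%N /\
        sees (polygon p) (p (s + (3 * k%:Z * eps)%:~R)) q.
Proof.
have n1 := n_gt1 hn.
have [|a aP see] := @good_starts_see R _ _ (iota 0 n) (third_hits n)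
  (fun i => p i%:R) n (iota 0 n) (polygon_simple hn hp); first by rewrite size_iota.
have : a != [::] by apply: contraNneq (good_starts_small hn) => <-.
case: a aP see => // s a aP see _; exists s%:R, 1; split; first by left.
move=> q; rewrite (polygonE hn hp) => /see[tri [hit vis]].
have /hasP[k _ /andP[kn st]] := hit s (mem_head _ _).
exists k; split => // y; rewrite segmentE => h; apply: (vis _ st).
rewrite Zp_nat_mod // natrD.
by move: h; rewrite mulr1 -PoszM -pmulrn.
Qed.
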